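(* Let $1 \le p < \infty$. Then there is a family $(E_U)_{U \in P(\omega)}$ of Borel equivalence relations on Polish spaces such that for every $U \in P(\omega)$ and every real $q > p$ we have $\mathbb{R}^\omega/\ell_p \le_B E_U \le_B \mathbb{R}^\omega/\ell_q$, and for all $U, V \in P(\omega)$, \[ U \subseteq^{*} V \Longleftrightarrow E_U \le_B E_V . \]
   Context: For $1\le r<\infty$, $\mathbb{R}^\omega/\ell_r$ denotes the equivalence relation on $\mathbb{R}^\omega$ given by $(x_n)\sim(y_n)$ iff $\sum_{n<\omega}|x_n-y_n|^r<\infty$. For equivalence relations $E,F$ on Polish spaces $X,Y$, $E\le_B F$ (Borel reducibility) means there is a Borel map $\theta:X\to Y$ with $xEy \iff \theta(x)F\theta(y)$ for all $x,y\in X$. $P(\omega)$ is the power set of $\omega=\{0,1,2,\dots\}$, and $U\subseteq^* V$ means $U\setminus V$ is finite. *)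

(* Defs.v *)
From Stdlib Require Export RelationClasses.
From mathcomp Require Export all_boot all_order all_algebra.
From mathcomp Require Export all_classical all_reals all_analysis.

Set Implicit Arguments.
Unset Strict Implicit.
Unset Printing Implicit Defensive.

Import Order.TTheory GRing.Theory Num.Theory.
Import numFieldNormedType.Exports.

Local Open Scope classical_set_scope.
Local Open Scope ring_scope.

Definition is_metric (R : realType) (X : Type) (d : X -> X -> R) : Prop :=
  [/\ forall x y, 0 <= d x y,
      forall x y, d x y = 0 <-> x = y,
      forall x y, d x y = d y x &
      forall x y z, d x z <= d x y + d y z].

Definition metric_compatible (R : realType) (X : topologicalType)
    (d : X -> X -> R) : Prop :=
  forall (x : X) (A : set X),
    nbhs x A <-> exists2 e : R, 0 < e & [set y | d x y < e] `<=` A.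

(* The limit is taken in the topology of [X], so this is completeness of [d]
   only in conjunction with [metric_compatible d]. *)
Definition metric_complete (R : realType) (X : topologicalType)
    (d : X -> X -> R) : Prop :=
  forall u : nat -> X,
    (forall e : R, 0 < e -> exists N : nat,
        forall m n : nat, (N <= m)%N -> (N <= n)%N -> d (u m) (u n) < e) ->
    exists x : X, u n @[n --> \oo] --> x.

Definition polish (R : realType) (X : topologicalType) : Prop :=
  (exists2 D : set X, countable D & dense D) /\
  (exists d : X -> X -> R,
     [/\ is_metric d, metric_compatible d & metric_complete d]).

(* [g_sigma_algebraType] would give the same sets, but requires a pointed
   carrier. *)
Definition borel (X : topologicalType) : set (set X) := <<s @open X >>.

(* Borel as a subset of the topological product [X * X]. *)
Definition borel_relation (X : topologicalType) (E : X -> X -> Prop) : Prop :=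
  @borel (X * X)%type [set xy | E xy.1 xy.2].

Definition borel_map (X Y : topologicalType) (theta : X -> Y) : Prop :=
  forall B : set Y, borel B -> borel (theta @^-1` B).

Definition borel_reducible (X Y : topologicalType)
    (E : X -> X -> Prop) (F : Y -> Y -> Prop) : Prop :=
  exists2 theta : X -> Y, borel_map theta &
    forall x x' : X, E x x' <-> F (theta x) (theta x').

(* The type [{ptws nat -> R}] is that of real sequences with the product
   topology. *)
Definition lr_equiv (R : realType) (r : R) (x y : {ptws nat -> R}) : Prop :=
  (\sum_(0 <= n <oo) (`|x n - y n| `^ r)%:E < +oo)%E.

Definition almost_subset (U V : set nat) : Prop := finite_set (U `\` V).

(* Main.v *)
(* E_U lives on the Baire space of integer sequences and reads
     x E_U y  iff  sum_n w_n |x_n - y_n|^(e_n) < oo.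
   Infinitely many coordinates n carry the data (2^(-n p), p) and code R^omega/l_p
   through dyadic approximations.  For each k infinitely many coordinates have
   type k; they carry (alpha_k, p_k) if k is in U and (1, p) otherwise, where
   p_k = p + 1/(k+1) and alpha_k decreases very fast.  On the coordinates of
   finitely many types, E_U only says that almost all entries agree, so changing
   U at finitely many k is harmless.  For q > p almost all p_k are bounded away
   from q, and the snowflake (Z, |.|^(p_k)) embeds into l_q by the functions
   2^(m p_k / q) sin(./2^m), with uniform constants; hence E_U <= R^omega/l_q.

   Conversely let theta reduce E_U to E_V.  By a Baire category argument (after
   Dougherty and Hjorth), theta becomes additive, up to a summable error, on
   suitable free coordinates x_0, x_1, ..: the output coordinates split into
   consecutive finite blocks, the i-th of which depends on x_i only.  If k is in
   U but not in V, let x_i have type k and run through 0, .., N with N = gsize k.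
   As long as the images of unit steps have E_V-cost O(alpha_k), they do not move
   the output coordinates of a type l < k or of a type outside V, for these cost
   too much; the other exponents of E_V are at most p_(k+1), so by convexity the
   images of 0 and N have cost O(N^(p_(k+1)) alpha_k), far below the E_U-cost
   N^(p_k) alpha_k of the pair (0, N).  For infinitely many such k, suitable
   repetitions of unit steps or of pairs (0, N) give two points that exactly one
   of the relations identifies. *)

Require Import Defs.
From mathcomp Require Import all_boot all_order all_algebra.
From mathcomp Require Import all_classical all_reals all_analysis.
From mathcomp Require Import ring lra zify.

Set Implicit Arguments.
Unset Strict Implicit.
Unset Printing Implicit Defensive.

Import Order.TTheory GRing.Theory Num.Theory.
Import numFieldNormedType.Exports.

Local Open Scope classical_set_scope.
Local Open Scope ring_scope.

(** * The space of sequences over a countable discrete space *)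

Definition agree {T : Type} (n : nat) (x y : nat -> T) : Prop :=
  forall i, (i < n)%N -> x i = y i.

Notation seqspace T := {ptws nat -> discrete_topology T}.

Lemma agree_sym {T : Type} n (x y : nat -> T) : agree n x y -> agree n y x.
Proof. by move=> xy i /xy. Qed.

Lemma agree_trans {T : Type} n (x y z : nat -> T) :
  agree n x y -> agree n y z -> agree n x z.
Proof. by move=> xy yz i lt_in; rewrite xy// yz. Qed.

Lemma agree_le {T : Type} m n (x y : nat -> T) :
  (m <= n)%N -> agree n x y -> agree m x y.
Proof. by move=> mn xy i im; apply: xy; exact: leq_trans im mn. Qed.

Lemma nbhs_agree (T : choiceType) n (x : seqspace T) :
  nbhs x [set y : seqspace T | agree n x y].
Proof.
elim: n => [|n IHn]; first by apply: filterS filterT.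
have nx : nbhs x ((@proj nat (fun=> discrete_topology T) n) @^-1` [set x n]).
  apply: (@proj_continuous nat (fun=> discrete_topology T) n x).
  exact: discrete_set1.
apply: filterS (filterI IHn nx) => y [xy /= yn] i.
by rewrite ltnS leq_eqVlt => /predU1P[->//|]; exact: xy.
Qed.

(** Prefix agreement with [x] generates a filter that converges to [x] coordinatewise, the factors
    being discrete; hence every product neighbourhood contains a cylinder. *)
Lemma nbhs_seqspaceP (T : choiceType) (x : seqspace T) (A : set (seqspace T)) :
  nbhs x A <-> exists n, forall y : seqspace T, agree n x y -> A y.
Proof.
split; last first.
  by case=> n nA; exact: filterS nA (nbhs_agree n x).
pose F : set_system (seqspace T) :=
  filter_from setT (fun n => [set y : seqspace T | agree n x y]).
have FF : Filter F.
  apply: filter_from_filter; first by exists 0%N.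
  move=> m n _ _; exists (maxn m n) => // y xy; split.
    exact: agree_le (leq_maxl _ _) xy.
  exact: agree_le (leq_maxr _ _) xy.
have Fx : {ptws, F --> (x : nat -> discrete_topology T)}.
  apply/pointwise_cvgP => t; apply/discrete_cvg.
  by exists t.+1 => // y /(_ t (ltnSn t)) /= ->.
by move=> /Fx [n _ nA]; exists n.
Qed.

Lemma open_seqspaceP (T : choiceType) (A : set (seqspace T)) :
  open A <-> forall x, A x -> exists n, forall y : seqspace T, agree n x y -> A y.
Proof.
rewrite openE; split => [oA x /oA /nbhs_seqspaceP//|oA x /oA nA].
exact/nbhs_seqspaceP.
Qed.

Lemma open_seqspace2 (T : choiceType) (A : set (seqspace T * seqspace T)) n :
  (forall x y x' y' : seqspace T, agree n x x' -> agree n y y' ->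
    A (x, y) -> A (x', y')) -> open A.
Proof.
move=> nA; rewrite openE => -[x y] Axy.
exists ([set x' : seqspace T | agree n x x'], [set y' : seqspace T | agree n y y']).
  by split; exact: nbhs_agree.
by move=> [x' y'] /= [xx' yy']; apply: nA Axy.
Qed.

(** * Sequence spaces over a countable set are Polish *)

Section polish.
Context (R : realType) (T : countType) (t0 : T).

Lemma neq_seq_ex (x y : nat -> T) : x <> y -> exists n, x n != y n.
Proof.
move=> xy; apply: contrapT => nxy; apply: xy; apply/funext => n.
by apply/eqP/negPn/negP => ne; apply: nxy; exists n.
Qed.

Definition seq_dist (x y : nat -> T) : R :=
  if pselect (x = y) is right ne then (ex_minn (neq_seq_ex ne)).+1%:R^-1 else 0.

Lemma seq_dist_ge0 x y : 0 <= seq_dist x y.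
Proof. by rewrite /seq_dist; case: pselect. Qed.

Lemma seq_dist_lt x y n : seq_dist x y < n.+1%:R^-1 <-> agree n.+1 x y.
Proof.
rewrite /seq_dist; case: pselect => [->|ne]; first by split.
case: ex_minnP => m xym minm; rewrite ltf_pV2 ?posrE// ltr_nat ltnS; split.
  move=> nm i; rewrite ltnS => lin; apply/eqP/negPn/negP => /minm.
  by rewrite leqNgt (leq_ltn_trans lin nm).
move=> xy; rewrite ltnNge; apply/negP => mn.
by move/eqP: xym; apply; apply: xy.
Qed.

Lemma small_natV (e : R) : 0 < e -> exists n, n.+1%:R^-1 < e.
Proof.
move=> e0; exists (Num.bound e^-1); rewrite invf_plt ?posrE//.
apply: lt_le_trans (Num.Theory.archi_boundP _) _; first by rewrite invr_ge0 ltW.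
by rewrite ler_nat.
Qed.

Lemma seq_dist_leP x y (e : R) : 0 <= e ->
  (forall n, e < n.+1%:R^-1 -> agree n.+1 x y) -> seq_dist x y <= e.
Proof.
move=> e0 exy; rewrite leNgt; apply/negP => exy'.
have xy0 : x <> y.
  by move=> xy; move: exy'; rewrite /seq_dist; case: pselect => //; rewrite ltNge e0.
move: exy'; rewrite {1}/seq_dist; case: pselect => // ne.
case: ex_minnP => m xym _ /exy /(_ m (ltnSn m)) xym'.
by rewrite xym' eqxx in xym.
Qed.

Lemma seq_dist_refl x : seq_dist x x = 0.
Proof. by rewrite /seq_dist; case: pselect. Qed.

Lemma seq_dist_eq0 x y : seq_dist x y = 0 <-> x = y.
Proof.
split=> [|->]; last exact: seq_dist_refl.
rewrite /seq_dist; case: pselect => // ne /eqP.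
by rewrite invr_eq0 pnatr_eq0.
Qed.

Lemma seq_dist_sym x y : seq_dist x y = seq_dist y x.
Proof.
wlog suff : x y / seq_dist x y <= seq_dist y x.
  by move=> H; apply/eqP; rewrite eq_le !H.
apply: seq_dist_leP; first exact: seq_dist_ge0.
by move=> n /seq_dist_lt/agree_sym.
Qed.

Lemma seq_dist_triangle x y z : seq_dist x z <= seq_dist x y + seq_dist y z.
Proof.
apply: seq_dist_leP; first by rewrite addr_ge0// seq_dist_ge0.
move=> n xyz; apply: (@agree_trans _ _ _ y); apply/seq_dist_lt.
  by apply: le_lt_trans xyz; rewrite lerDl seq_dist_ge0.
by apply: le_lt_trans xyz; rewrite lerDr seq_dist_ge0.
Qed.

Lemma seq_dist_compatible : metric_compatible (seq_dist : seqspace T -> seqspace T -> R).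
Proof.
move=> x A; split.
  move=> /nbhs_seqspaceP[n nA]; exists n.+1%:R^-1 => //= y /seq_dist_lt xy.
  exact: nA (agree_le (leqnSn n) xy).
move=> [e /small_natV[n ne] eA]; apply/nbhs_seqspaceP; exists n.+1 => y xy.
by apply: eA => /=; apply: lt_trans ne; exact/seq_dist_lt.
Qed.

Lemma seq_dist_complete : metric_complete (seq_dist : seqspace T -> seqspace T -> R).
Proof.
move=> u cu.
have /choice[N HN] : forall n, exists N : nat, forall m k : nat,
    (N <= m)%N -> (N <= k)%N -> agree n.+1 (u m) (u k).
  move=> n; have [|N HN] := cu n.+1%:R^-1; first by rewrite invr_gt0.
  by exists N => m k Nm Nk; apply/seq_dist_lt; exact: HN.
(* From stage [N i] on the entries up to [i] no longer change, so the limit reads its entry [i]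
   there. *)
exists (fun i => u (N i) i) => A /nbhs_seqspaceP[n nA].
exists (\max_(i < n) N i)%N => // k /= Nk; apply: nA => i lin.
apply: (HN i) => //; apply: leq_trans Nk.
exact: (@leq_bigmax _ (fun i : 'I_n => N i) (Ordinal lin)).
Qed.

Lemma polish_seqspace : polish R (seqspace T).
Proof.
split; last first.
  exists seq_dist; split.
  - split; [exact: seq_dist_ge0|exact: seq_dist_eq0|exact: seq_dist_sym|].
    exact: seq_dist_triangle.
  - exact: seq_dist_compatible.
  - exact: seq_dist_complete.
exists [set ((fun i => nth t0 s i) : seqspace T) | s in [set: seq T]].
  exact: sub_countable (card_image_le _ _) (countableP _).
move=> A [x Ax] /open_seqspaceP/(_ x Ax)[n nA].
exists (fun i => nth t0 (mkseq x n) i); split; last by exists (mkseq x n).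
by apply: nA => i lin; rewrite nth_mkseq.
Qed.

End polish.

(** * Borel sets and Borel maps *)

Lemma borel_open (X : topologicalType) (A : set X) : open A -> borel A.
Proof. by move=> oA; exact: sub_sigma_algebra. Qed.

Lemma borel0 (X : topologicalType) : borel (set0 : set X).
Proof. exact: sigma_algebra0. Qed.

Lemma borelT (X : topologicalType) : borel (setT : set X).
Proof. by apply: borel_open; exact: openT. Qed.

Lemma borelC (X : topologicalType) (A : set X) : borel A -> borel (~` A).
Proof. by move=> bA; rewrite -setTD; exact: sigma_algebraCD. Qed.

Lemma borel_bigcup (X : topologicalType) (F : nat -> set X) :
  (forall i, borel (F i)) -> borel (\bigcup_i F i).
Proof. by move=> bF; exact: sigma_algebra_bigcup. Qed.

Lemma borel_bigcap (X : topologicalType) (F : nat -> set X) :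
  (forall i, borel (F i)) -> borel (\bigcap_i F i).
Proof.
move=> bF; rewrite -[X in borel X]setCK setC_bigcap; apply: borelC.
by apply: borel_bigcup => i; exact: borelC.
Qed.

Lemma borelI (X : topologicalType) (A B : set X) :
  borel A -> borel B -> borel (A `&` B).
Proof.
move=> bA bB; rewrite -bigcap2E; apply: borel_bigcap => -[|[|i]]//=.
exact: borelT.
Qed.

Lemma borel_mapP (X Y : topologicalType) (f : X -> Y) :
  (forall A : set Y, open A -> borel (f @^-1` A)) -> borel_map f.
Proof.
move=> fo B bB; apply: (bB [set C | borel (f @^-1` C)]); split; last by move=> A; exact: fo.
split=> [|A bA|F bF].
- by rewrite /= preimage_set0; exact: borel0.
- by rewrite /= setTD preimage_setC; exact: borelC.
- by rewrite /= preimage_bigcup; exact: borel_bigcup.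
Qed.

(** There are countably many finite sequences, so an open set is a countable union of cylinders, and
    the preimage of a cylinder is an intersection of the given Borel sets. *)
Lemma borel_map_seqspace (X : topologicalType) (T : countType) (t0 : T)
    (f : X -> seqspace T) :
  (forall n v, borel [set x | f x n = v]) -> borel_map f.
Proof.
move=> bf; apply: borel_mapP => A /open_seqspaceP oA.
pose C (s : seq T) : set X :=
  if pselect (forall y : seqspace T, agree (size s) (nth t0 s) y -> A y) then
    \bigcap_i (if (i < size s)%N then [set x | f x i = nth t0 s i] else setT)
  else set0.
have -> : f @^-1` A = \bigcup_i (if unpickle i is Some s then C s else set0).
  apply/seteqP; split => x.
    move=> /oA[n nA]; exists (pickle (mkseq (f x) n)) => //.
    rewrite pickleK /C; case: pselect => [_ i _|[]].
        by case: ifP => //; rewrite size_mkseq => lin; rewrite nth_mkseq.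
    move=> y; rewrite size_mkseq => xy; apply: nA => i lin.
    by rewrite -xy// nth_mkseq.
  move=> [i _]; case: unpickle => // s; rewrite /C; case: pselect => //= sA Cx.
  by apply: (sA (f x)) => j js; have := Cx j I; rewrite js.
apply: (@borel_bigcup X) => i.
rewrite /C; case: pselect => [?|?] /=; last exact: borel0.
apply: (@borel_bigcap X) => j; case: ifP => _; first exact: bf.
exact: borelT.
Qed.
(** * Baire category for sequences *)

Section baire.
Context (T : countType) (t0 : T).
Implicit Types (s t : seq T) (x y : nat -> T) (A : set (nat -> T)).

Definition inn s : set (nat -> T) := [set y | agree (size s) (nth t0 s) y].

Definition dense_open (O : seq T -> Prop) : Prop :=
  (forall s t, O s -> O (s ++ t)) /\ (forall s, exists t, O (s ++ t)).

Definition generic (O : nat -> seq T -> Prop) : set (nat -> T) :=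
  [set y | forall n, exists m, O n (mkseq y m)].

(* The usual meager sets: each [dense_open (O n)] stands for the dense open set of
   the sequences with a prefix satisfying it. *)
Definition meager A : Prop :=
  exists2 O : nat -> seq T -> Prop,
    (forall n, dense_open (O n)) & A `&` generic O = set0.

Lemma inn_mkseq s y : inn s y <-> mkseq y (size s) = s.
Proof.
split=> [sy|sy i si]; last by rewrite -{1}sy nth_mkseq.
apply: (@eq_from_nth _ t0); rewrite size_mkseq// => i si.
by rewrite nth_mkseq// sy.
Qed.

Lemma inn_catl s t y : inn (s ++ t) y -> inn s y.
Proof.
move=> sty i si; rewrite -(sty i) ?size_cat ?ltn_addr//.
by rewrite nth_cat si.
Qed.

Lemma mkseq_inn y n : inn (mkseq y n) y.
Proof. by move=> i; rewrite size_mkseq => lin; rewrite nth_mkseq. Qed.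

Lemma mkseq_cat y m n : (m <= n)%N -> exists t, mkseq y n = mkseq y m ++ t.
Proof.
move=> mn; exists (drop m (mkseq y n)); rewrite -{1}(cat_take_drop m (mkseq y n)).
by rewrite /mkseq -map_take take_iota (minn_idPl mn).
Qed.

Lemma inn_mkseq_cat s y m : inn s y -> (size s <= m)%N ->
  exists t, mkseq y m = s ++ t.
Proof. by move=> /inn_mkseq sy /mkseq_cat - /(_ y)[t ->]; exists t; rewrite sy. Qed.

Lemma dense_openT : dense_open (fun=> True).
Proof. by split=> // s; exists [::]. Qed.

(** Each [S n] has length at least [n], so entry [i] of the limit can be read off [S i.+1]; any two
    stages are prefixes of a common later one, hence compatible. *)
Lemma seq_limit (S : nat -> seq T) (g : nat -> seq T) :
  (forall n, S n.+1 = S n ++ g n) -> (forall n, (0 < size (g n))%N) ->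
  forall n, inn (S n) (fun i => nth t0 (S i.+1) i).
Proof.
move=> Sg g0 n i iSn.
have Sle m k : exists t, S (m + k)%N = S m ++ t.
  elim: k => [|k [t St]]; first by exists [::]; rewrite addn0 cats0.
  by exists (t ++ g (m + k)%N); rewrite addnS Sg St catA.
have sizeS k : (k <= size (S k))%N.
  elim: k => // k IHk; rewrite Sg size_cat -addn1.
  exact: leq_add IHk (g0 k).
have [t St] := Sle n i.+1; have [u Su] := Sle i.+1 n.
have : nth t0 (S (n + i.+1)%N) i = nth t0 (S (i.+1 + n)%N) i by rewrite addnC.
by rewrite St Su !nth_cat iSn sizeS.
Qed.

Lemma baire_seq (O : nat -> seq T -> Prop) s : (forall n, dense_open (O n)) ->
  exists2 y, inn s y & generic O y.
Proof.
move=> dO.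
have /choice[f Hf] : forall ns : nat * seq T, exists t, O ns.1 (ns.2 ++ t).
  by move=> [n r]; case: (dO n) => _; exact.
pose S := fix S n := if n is k.+1 then S k ++ rcons (f (k, S k)) t0 else s.
pose y i := nth t0 (S i.+1) i.
have Sy n : inn (S n) y.
  apply: (@seq_limit S (fun k => rcons (f (k, S k)) t0)) => // k.
  by rewrite size_rcons.
exists y; first exact: (Sy 0%N).
move=> n; exists (size (S n.+1)); have /inn_mkseq -> := Sy n.+1.
by rewrite /= -cats1 catA; apply: (dO n).1; exact: (Hf (n, S n)).
Qed.

Lemma meager_sub A B : A `<=` B -> meager B -> meager A.
Proof.
move=> AB [D dO BO]; exists D => //; apply/seteqP; split=> // y [/AB By Oy].
by have : set0 y by rewrite -BO.
Qed.

Lemma not_meager_inn s : ~ meager (inn s).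
Proof.
move=> [D dO sO]; have [y sy Oy] := baire_seq s dO.
by have : set0 y by rewrite -sO.
Qed.

Lemma meager_bigcup (I : countType) (A : I -> set (nat -> T)) :
  (forall i, meager (A i)) -> meager (\bigcup_i A i).
Proof.
move=> mA.
have /choice[D HD] : forall i, exists D : nat -> seq T -> Prop,
    (forall n, dense_open (D n)) /\ A i `&` generic D = set0.
  by move=> i; have [D dD AD] := mA i; exists D.
pose O k := if unpickle k is Some (i, n) then D i n else fun=> True.
exists O => [k|].
  rewrite /O; case: (unpickle k) => [[i n]|]; last exact: dense_openT.
  exact: (HD i).1.
apply/seteqP; split=> // y [[i _ Aiy] Oy].
rewrite -(HD i).2; split=> // n.
by have := Oy (pickle (i, n)); rewrite /O pickleK.
Qed.

Lemma meager0 : meager set0.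
Proof. by exists (fun _ _ => True) => [n|]; rewrite ?set0I//; exact: dense_openT. Qed.

Lemma meager_if (P : Prop) A : (P -> meager A) ->
  meager (if pselect P then A else set0).
Proof. by case: pselect => [p|?] /=; [exact|move=> _; exact: meager0]. Qed.

Lemma meager_not_hit D : dense_open D -> meager [set y | ~ exists m, D (mkseq y m)].
Proof.
move=> dD; exists (fun=> D) => //; apply/seteqP; split=> // y [nDy /(_ 0%N)].
by apply: contraPP => _; exact: nDy.
Qed.

(** A form of the Banach category theorem: the countably many cylinders below [s] in which [A] is
    meager have a dense union there, so what they miss is nowhere dense. *)
Lemma meager_local s A :
  (forall t, exists t', meager (inn (s ++ t ++ t') `&` A)) -> meager (inn s `&` A).
Proof.
move=> H.
(* The second alternative, for [r] incompatible with [s], makes [D] dense outside the cylinder of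
   [s] as well. *)
pose D r := (exists t t', r = s ++ t ++ t' /\ meager (inn (s ++ t) `&` A)) \/
  ((size s <= size r)%N /\ take (size s) r <> s).
have dD : dense_open D.
  split=> [r u [[t [t' [-> mt]]]|[sr rs]]|r].
  - by left; exists t, (t' ++ u); rewrite !catA.
  - right; rewrite size_cat (leq_trans sr) ?leq_addr//; split=> //.
    by rewrite takel_cat.
  have [rs|rs] := pselect (take (size s) (r ++ s) = s); last first.
    by exists s; right; rewrite size_cat leq_addl.
  have [t' mt] := H (drop (size s) (r ++ s)).
  exists (s ++ t'); left; exists (drop (size s) (r ++ s) ++ t'), [::].
  rewrite cats0; split; last by [].
  by rewrite -{2}rs !catA cat_take_drop.
pose B t := if pselect (meager (inn (s ++ t) `&` A)) then inn (s ++ t) `&` A else set0.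
have mB : meager (\bigcup_i (if i is Some t then B t else [set y | ~ exists m, D (mkseq y m)])).
  apply: meager_bigcup => -[t|]; last exact: meager_not_hit.
  exact: meager_if.
apply: meager_sub mB => y [sy Ay].
have [[m Dm]|nD] := pselect (exists m, D (mkseq y m)); last by exists None.
case: Dm => [[t [t' [yt mt]]]|[sm]]; last first.
  have [u ->] : exists u, mkseq y m = s ++ u.
    by apply: inn_mkseq_cat => //; rewrite size_mkseq in sm.
  by rewrite take_size_cat.
exists (Some t) => //; rewrite /B; case: pselect => // ? /=; split=> //.
by apply: (@inn_catl _ t'); rewrite -catA -yt; exact: mkseq_inn.
Qed.

Lemma baire_countable (I : countType) (D : I -> seq T -> Prop) s :
  (forall i, dense_open (D i)) ->
  exists2 y, inn s y & forall i, exists m, D i (mkseq y m).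
Proof.
move=> dD.
have [|y sy Dy] := @baire_seq (fun k => if unpickle k is Some i then D i else fun=> True) s.
  by move=> k; case: (unpickle k) => [i|]; [exact: dD|exact: dense_openT].
by exists y => // i; have := Dy (pickle i); rewrite pickleK.
Qed.

Lemma dense_open_shift D u : dense_open D -> dense_open (fun t => D (u ++ t)).
Proof.
move=> [De Dd]; split=> [s t|s]; first by rewrite catA; exact: De.
by have [t] := Dd (u ++ s); rewrite -catA; exists t.
Qed.

Lemma dense_open_all (I : eqType) (l : seq I) (D : I -> seq T -> Prop) s :
  (forall i, dense_open (D i)) -> exists t, forall i, i \in l -> D i (s ++ t).
Proof.
move=> dD; elim: l => [|i l [t IHl]]; first by exists [::].
have [t' Dt'] := (dD i).2 (s ++ t); exists (t ++ t') => k.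
rewrite inE => /predU1P[->|/IHl]; rewrite catA//.
exact: (dD k).1.
Qed.

(* A form of the Baire property that is visibly stable under countable unions. *)
Definition decided A : Prop :=
  forall s, exists t, meager (inn (s ++ t) `&` A) \/ meager (inn (s ++ t) `&` ~` A).

(** For a countable union: if some member is comeager in a cylinder below [s], so is the union;
    otherwise every member, being decided, is meager below every extension of [s], hence in [s] by
    [meager_local]. *)
Lemma decided_sigma_algebra : sigma_algebra setT decided.
Proof.
split=> [s|A dA s|F dF s].
- by exists [::]; left; rewrite setI0; exact: meager0.
- by have [t [mt|mt]] := dA s; exists t; [right|left]; rewrite setTD// setCK.
have [[n [t mt]]|nF] := pselect (exists n t, meager (inn (s ++ t) `&` ~` F n)).
  exists t; right; apply: meager_sub mt => y [sy nFy]; split=> // Fy.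
  by apply: nFy; exists n.
exists [::]; left; rewrite cats0 setI_bigcupr; apply: meager_bigcup => n.
apply: meager_local => t; have [t' [mt|mt]] := dF n (s ++ t).
  by exists t'; rewrite catA.
by exfalso; apply: nF; exists n, (t ++ t'); rewrite catA.
Qed.

Lemma decided_open (A : set (seqspace T)) : open A -> decided A.
Proof.
move=> /open_seqspaceP oA s.
have [[y [sy /oA[n nA]]]|ns] := pselect (exists y : seqspace T, inn s y /\ A y).
  have [t yt] : exists t, mkseq y (maxn (size s) n) = s ++ t.
    exact: inn_mkseq_cat sy (leq_maxl _ _).
  exists t; right; rewrite -yt; apply: meager_sub meager0 => x [yx]; apply.
  apply: nA => i lin; have {}lin := leq_trans lin (leq_maxr (size s) n).
  by rewrite -yx ?nth_mkseq ?size_mkseq.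
exists [::]; left; rewrite cats0; apply: meager_sub meager0 => y [sy Ay].
by apply: ns; exists y.
Qed.

Lemma decided_borel (A : set (seqspace T)) : borel A -> decided A.
Proof.
move=> bA; apply: (bA decided); split; first exact: decided_sigma_algebra.
by move=> B; exact: decided_open.
Qed.

(** Borel maps are continuous on a comeager set. If no extension of [s] decided entry [j] of the
    output up to a meager set, each of the countably many sets where this entry is [v] would be
    meager in [s], against the Baire category theorem. *)
Lemma generic_continuous (T' : countType) (th : seqspace T -> seqspace T') :
  borel_map th ->
  exists2 O : nat -> seq T -> Prop, (forall n, dense_open (O n)) &
    forall y, generic O y -> forall j, exists m, forall y', generic O y' ->
      agree m y y' -> th y j = th y' j.
Proof.
move=> bth.
pose A j v : set (seqspace T) := [set y | th y j = v].
have bA j v : borel (A j v).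
  apply: (bth [set z : seqspace T' | z j = v]).
  apply: borel_open; apply/open_seqspaceP => z /= zv; exists j.+1 => z' zz'.
  by rewrite /= -zz'.
pose D j s := exists v, meager (inn s `&` ~` A j v).
have dD j : dense_open (D j).
  split=> [s t [v mv]|s].
    by exists v; apply: meager_sub mv => y [/inn_catl sy Ay].
  apply: contrapT => nD; apply: (@not_meager_inn s).
  have -> : inn s = \bigcup_v (inn s `&` A j v).
    rewrite -setI_bigcupr; apply/seteqP; split=> [y sy|y []//].
    by split=> //; exists (th y j).
  apply: meager_bigcup => v; apply: meager_local => t.
  have [t' [mt|mt]] := decided_borel (bA j v) (s ++ t).
    by exists t'; rewrite catA.
  by exfalso; apply: nD; exists (t ++ t'), v; rewrite catA.
(* The points to discard: those no prefix of which decides entry [j], and those where a deciding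
   prefix gives the wrong value. *)
pose M (i : nat + (nat * seq T * T')) := match i with
  | inl j => [set y | ~ exists m, D j (mkseq y m)]
  | inr (j, s, v) => if pselect (meager (inn s `&` ~` A j v)) then inn s `&` ~` A j v
     else set0
  end.
have [D' dD' MD'] : meager (\bigcup_i M i).
  apply: meager_bigcup => -[j|[[j s] v]]; first exact: meager_not_hit.
  exact: meager_if.
have nM y i : generic D' y -> ~ M i y.
  move=> Dy My; suff : set0 y by [].
  by rewrite -MD'; split=> //; exists i.
exists D' => // y Dy j.
have [m [v mv]] : exists m, D j (mkseq y m).
  by apply: contrapT => nD; exact: (nM y (inl j) Dy).
have th_v z : generic D' z -> inn (mkseq y m) z -> th z j = v.
  move=> Dz yz; apply: contrapT => zv; apply: (nM z (inr (j, mkseq y m, v)) Dz).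
  by rewrite /M; case: pselect.
exists m => z Dz yz; rewrite (th_v y)//; last exact: mkseq_inn.
rewrite (th_v z)// => i; rewrite size_mkseq => im.
by rewrite nth_mkseq// yz.
Qed.

End baire.
(** * Summability of nonnegative sequences *)

Section bounded_sums.
Context {R : realType}.
Implicit Types (a b : nat -> R).

(** For nonnegative terms this is convergence of the series, without limits or extended reals. *)
Definition bsum a : Prop := exists M : R, forall n, \sum_(0 <= i < n) a i <= M.

Lemma sum_nat_ge0 a m n : (forall i, 0 <= a i) -> 0 <= \sum_(m <= i < n) a i.
Proof. by move=> a0; rewrite sumr_ge0. Qed.

Lemma sum_nat_mono a m n : (forall i, 0 <= a i) -> (m <= n)%N ->
  \sum_(0 <= i < m) a i <= \sum_(0 <= i < n) a i.
Proof.
by move=> a0 mn; rewrite (big_cat_nat (leq0n m) mn)/= lerDl sum_nat_ge0.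
Qed.

Lemma bsum_le a b : (forall i, a i <= b i) -> bsum b -> bsum a.
Proof.
move=> ab [M bM]; exists M => n; apply: le_trans (bM n).
exact: ler_sum.
Qed.

Lemma bsumD a b : bsum a -> bsum b -> bsum (fun i => a i + b i).
Proof.
move=> [M aM] [N bN]; exists (M + N) => n.
by rewrite big_split lerD.
Qed.

Lemma bsumZ (c : R) a : 0 <= c -> bsum a -> bsum (fun i => c * a i).
Proof.
move=> c0 [M aM]; exists (c * M) => n.
by rewrite -mulr_sumr ler_wpM2l.
Qed.

Lemma bsum_eventually a b k : (forall i, (k <= i)%N -> a i <= b i) ->
  (forall i, 0 <= a i) -> (forall i, 0 <= b i) -> bsum b -> bsum a.
Proof.
move=> ab a0 b0 [M bM]; exists (\sum_(0 <= i < k) a i + M) => n.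
have [nk|kn] := leqP n k.
  rewrite -[leLHS]addr0 lerD// ?sum_nat_mono//.
  by apply: le_trans (bM 0%N); rewrite big_geq.
rewrite (big_cat_nat (leq0n k) (ltnW kn))/= lerD2l.
apply: le_trans (bM n); rewrite [leRHS](big_cat_nat (leq0n k) (ltnW kn))/=.
rewrite ler_wpDl ?sum_nat_ge0// !big_nat; apply: ler_sum => i /andP[ki _].
exact: ab.
Qed.

Lemma bsum_tail a (e : R) : (forall i, 0 <= a i) -> 0 < e -> bsum a ->
  exists N, forall M, \sum_(N <= i < M) a i <= e.
Proof.
move=> a0 e0 [B aB]; apply: contrapT => nN.
have {}nN N : exists M, e < \sum_(N <= i < M) a i.
  apply: contrapT => nM; apply: nN; exists N => M.
  by rewrite leNgt; apply/negP => eM; apply: nM; exists M.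
have ke k : exists M, k%:R * e <= \sum_(0 <= i < M) a i.
  elim: k => [|k [M kM]]; first by exists 0%N; rewrite mul0r big_geq.
  have [M' eM'] := nN M.
  have MM' : (M <= M')%N.
    rewrite leqNgt; apply/negP => /ltnW MM'.
    by move: eM'; rewrite big_geq// ltNge (ltW e0).
  exists M'; rewrite (big_cat_nat (leq0n M) MM')/= -natr1 mulrDl mul1r.
  by rewrite lerD// ltW.
have [k kB] : exists k : nat, B < k%:R * e.
  exists (Num.bound `|B / e|); rewrite -ltr_pdivrMr//.
  by apply: le_lt_trans (ler_norm _) _; apply: archi_boundP.
have [M kM] := ke k.
by have := lt_le_trans kB (le_trans kM (aB M)); rewrite ltxx.
Qed.

Lemma bsum_eventually_lt a (e : R) : (forall i, 0 <= a i) -> 0 < e -> bsum a ->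
  exists k, forall i, (k <= i)%N -> a i < e.
Proof.
move=> a0 e0 /(bsum_tail a0 (e := e / 2))[|N HN]; first by rewrite divr_gt0.
exists N => i Ni; have := HN i.+1; rewrite big_nat_recr//= => ai.
apply: (@le_lt_trans _ _ (e / 2)); last by lra.
by apply: le_trans ai; rewrite ler_wpDl// sum_nat_ge0.
Qed.

Lemma bsum_sparse a (q : nat -> nat) : (forall i, 0 <= a i) ->
  (forall i, (q i < q i.+1)%N) -> (forall n, (forall i, n <> q i) -> a n = 0) ->
  bsum a <-> bsum (a \o q).
Proof.
move=> a0 q_incr aq.
have q_mono i k : (i < k)%N -> (q i < q k)%N.
  elim: k => // k IHk; rewrite ltnS leq_eqVlt => /predU1P[->//|/IHk].
  by move=> /ltn_trans; exact.
have sumq K : \sum_(0 <= n < q K) a n = \sum_(0 <= i < K) a (q i).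
  elim: K => [|K IHK].
    rewrite [RHS]big_geq// big_nat big1// => n /andP[_ nq]; apply: aq => i ni.
    move: nq; rewrite ni; case: i {ni} => [|i]; first by rewrite ltnn.
    by rewrite ltnNge ltnW// q_mono.
  rewrite big_nat_recr//= -IHK (big_cat_nat (leq0n _) (ltnW (q_incr K)))/=.
  congr (_ + _); rewrite big_ltn//= big_nat big1 ?addr0// => n /andP[qn nq].
  apply: aq => i ni; move: qn nq; rewrite ni; have [iK|Ki|->] := ltngtP i K.
  - by rewrite ltnNge ltnW// q_mono.
  - move=> _; rewrite ltnNge; move: Ki; rewrite leq_eqVlt.
    by move=> /predU1P[<-|/q_mono/ltnW ->//]; rewrite leqnn.
  - by rewrite ltnn.
have q_ge K : (K <= q K)%N.
  by elim: K => // K IHK; apply: leq_ltn_trans IHK _.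
split=> -[M aM]; exists M => n.
  by rewrite /= -sumq.
by apply: le_trans (aM n); rewrite /= -sumq sum_nat_mono.
Qed.

Lemma bsum_blocks a (N : nat -> nat) : (forall i, 0 <= a i) ->
  N 0%N = 0%N -> (forall i, (N i < N i.+1)%N) ->
  bsum a <-> bsum (fun i => \sum_(N i <= j < N i.+1) a j).
Proof.
move=> a0 N0 N_incr.
have sumN K : \sum_(0 <= j < N K) a j = \sum_(0 <= i < K) \sum_(N i <= j < N i.+1) a j.
  elim: K => [|K IHK]; first by rewrite N0 !big_geq.
  by rewrite big_nat_recr//= -IHK (big_cat_nat (leq0n _) (ltnW (N_incr K))).
have N_ge K : (K <= N K)%N.
  by elim: K => // K IHK; apply: leq_ltn_trans IHK _.
split=> -[M aM]; exists M => n.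
  by rewrite -sumN.
by apply: le_trans (aM n); rewrite -sumN sum_nat_mono.
Qed.

Lemma bsum_geometric : bsum (fun i => 2^-1 ^+ i : R).
Proof.
exists 2 => n; suff -> : \sum_(0 <= i < n) (2^-1 ^+ i : R) = 2 - 2 * 2^-1 ^+ n.
  by rewrite gerBl mulr_ge0// exprn_ge0// invr_ge0.
elim: n => [|n IHn]; first by rewrite big_geq// expr0 mulr1 subrr.
by rewrite big_nat_recr//= IHn exprS; field.
Qed.

End bounded_sums.
(** * Additive form of a generically continuous map *)

Section additive.
Context (R : realType) (T T' : countType) (t0 : T).
Context (th : (nat -> T) -> nat -> T') (O : nat -> seq T -> Prop).
Context (g : nat -> T' -> T' -> R).
Hypothesis dO : forall n, dense_open (O n).
Hypothesis th_cont : forall y, generic O y -> forall j, exists m,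
  forall y', generic O y' -> agree m y y' -> th y j = th y' j.
Hypothesis g_ge0 : forall j a b, 0 <= g j a b.
Hypothesis th_fin : forall x y, (exists n, forall i, (n <= i)%N -> x i = y i) ->
  bsum (fun j => g j (th x j) (th y j)).
Implicit Types (s t u : seq T) (x y z : nat -> T).

Local Notation inn := (inn t0).

(** Under a common continuation, replacing the prefix [u] by [u'] perturbs the output from [N] on by
    at most [e] in total; this is what later makes an output block forget the earlier free
    coordinates. *)
Definition tail_small (e : R) (N : nat) u u' : Prop := forall y y',
  generic O y -> generic O y' -> inn u y -> inn u' y' ->
  (forall i, (size u' <= i)%N -> y i = y' i) ->
  forall M, \sum_(N <= j < M) g j (th y j) (th y' j) <= e.

Lemma tail_small_catl e N u t u' : tail_small e N u u' -> tail_small e N (u ++ t) u'.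
Proof. by move=> H y y' Oy Oy' /inn_catl uy; exact: H. Qed.

Lemma tail_small_le e N N' u u' : (N <= N')%N ->
  tail_small e N u u' -> tail_small e N' u u'.
Proof.
move=> NN' H y y' Oy Oy' uy uy' yy' M; apply: le_trans (H y y' Oy Oy' uy uy' yy' M).
have [MN|NM] := leqP M N'; first by rewrite big_geq// sum_nat_ge0.
by rewrite [leRHS](big_cat_nat NN' (ltnW NM))/= lerDr sum_nat_ge0.
Qed.

Lemma th_cont_below y M : generic O y -> exists m, forall y', generic O y' ->
  agree m y y' -> forall j, (j < M)%N -> th y j = th y' j.
Proof.
move=> Oy; elim: M => [|M [m IHM]]; first by exists 0%N.
have [m' Hm'] := th_cont Oy M; exists (maxn m m') => y' Oy' yy' j.
rewrite ltnS leq_eqVlt => /predU1P[->|jM].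
  exact: Hm' Oy' (agree_le (leq_maxr _ _) yy').
exact: IHM Oy' (agree_le (leq_maxl _ _) yy') _ jM.
Qed.

Definition glue u z : nat -> T := fun i =>
  if (i < size u)%N then nth t0 u i else z (i - size u)%N.

Lemma mkseq_glue u z m : mkseq (glue u z) (size u + m) = u ++ mkseq z m.
Proof.
apply: (@eq_from_nth _ t0); first by rewrite size_cat !size_mkseq.
move=> i; rewrite size_mkseq => im; rewrite nth_mkseq// nth_cat /glue.
case: ltnP => // ui; rewrite nth_mkseq//.
by rewrite ltn_subLR.
Qed.

Lemma inn_glue u z : inn u (glue u z).
Proof. by move=> i ui; rewrite /glue ui. Qed.

(* If no finite stage made the tail small, a generic common tail would make it
   large at all stages, against the summability for eventually equal points. *)
Lemma tail_small_dense e u u' t : 0 < e -> size u = size u' ->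
  exists t' N, tail_small e N (u ++ t ++ t') u'.
Proof.
move=> e0 suu'; apply: contrapT => nt.
pose big N r := exists M, forall y y', generic O y -> generic O y' ->
  inn (u ++ t ++ r) y -> inn u' y' -> (forall i, (size u' <= i)%N -> y i = y' i) ->
  e < \sum_(N <= j < M) g j (th y j) (th y' j).
have dbig N : dense_open (big N).
  split=> [r r' [M HM]|r].
    exists M => y y' Oy Oy' uy; apply: HM => //; apply: (@inn_catl _ _ _ r').
    by rewrite -!catA.
  apply: contrapT => nr; apply: nt; exists r, N => y y' Oy Oy' uy uy' yy' M.
  rewrite leNgt; apply/negP => eM; apply: nr.
  (* The sum up to [M] involves finitely many outputs, so by continuity finite prefixes of [y] and
     [y'] already force it above [e]. *)
  have [m Hm] := th_cont_below M Oy; have [m' Hm'] := th_cont_below M Oy'.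
  have [r' yr'] : exists r', mkseq y (maxn (size (u ++ t ++ r)) (maxn m m')) =
      (u ++ t ++ r) ++ r'.
    exact: inn_mkseq_cat uy (leq_maxl _ _).
  exists r', M => z z' Oz Oz'.
  rewrite (_ : u ++ t ++ _ = (u ++ t ++ r) ++ r'); last by rewrite -!catA.
  rewrite -yr' => yz uz' zz'.
  have {}yz : agree (maxn m m') y z.
    move=> i im; have {}im := leq_trans im (leq_maxr (size (u ++ t ++ r)) _).
    by rewrite -yz ?nth_mkseq ?size_mkseq.
  have yz' : agree (maxn m m') y' z'.
    move=> i im; have [ui|iu] := leqP (size u') i; last by rewrite -uz'// uy'.
    by rewrite -zz'// -yz// yy'.
  rewrite (_ : \sum_(N <= j < M) _ = \sum_(N <= j < M) g j (th y j) (th y' j))//.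
  rewrite !big_nat; apply: eq_bigr => j /andP[_ jM].
  rewrite (Hm z)//; last exact: agree_le (leq_maxl _ _) yz.
  by rewrite (Hm' z')//; exact: agree_le (leq_maxr _ _) yz'.
pose D (k : nat + (nat + nat)) r := match k with
  | inl N => big N r | inr (inl n) => O n ((u ++ t) ++ r)
  | inr (inr n) => O n ((u' ++ t) ++ r) end.
have [k|z _ Dz] := @baire_countable T t0 _ D [::].
  case: k => [N|[n|n]]; [exact: dbig| |];
  exact: (@dense_open_shift T (O n)).
have Oz : generic O (glue (u ++ t) z).
  by move=> n; have [m Dm] := Dz (inr (inl n)); exists (size (u ++ t) + m)%N;
    rewrite mkseq_glue.
have Oz' : generic O (glue (u' ++ t) z).
  by move=> n; have [m Dm] := Dz (inr (inr n)); exists (size (u' ++ t) + m)%N;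
    rewrite mkseq_glue.
have zz' i : (size u' <= i)%N -> glue (u ++ t) z i = glue (u' ++ t) z i.
  move=> ui; rewrite /glue !size_cat suu'; case: ltnP => // iut.
  by rewrite !nth_cat suu' ltnNge ui.
have [|N HN] := bsum_tail _ e0
    (@th_fin (glue (u ++ t) z) (glue (u' ++ t) z) (ex_intro _ _ zz')).
  by move=> j; exact: g_ge0.
have [m [M HM]] := Dz (inl N).
have := HM _ _ Oz Oz' _ _ zz'; rewrite ltNge HN => H.
suff : false by []; apply: H.
- apply/inn_mkseq; rewrite catA size_cat size_mkseq mkseq_glue.
  by [].
- by apply: (@inn_catl _ _ _ t); exact: inn_glue.
Qed.

(** One extension serves the whole finite list [Q], because all demands survive further extension
    and can be met one after another: [t1] makes the tails small, which determines [N']; then [t2]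
    decides the outputs below [N'] and enters the first [i] dense open sets. *)
Lemma stage (i N : nat) (Q : seq (seq T)) (e : R) : 0 < e ->
  {in Q &, forall u u', size u = size u'} ->
  exists t N', [/\ (N < N')%N,
    {in Q &, forall u u', tail_small e N' (u ++ t) u'},
    {in Q, forall u, forall j, (j < N')%N -> exists v, forall y,
      generic O y -> inn (u ++ t) y -> th y j = v} &
    {in Q, forall u, forall n, (n < i)%N -> O n (u ++ t)}].
Proof.
move=> e0 sQ.
pose D1 (uu : seq T * seq T) t := size uu.1 = size uu.2 ->
  exists N', tail_small e N' (uu.1 ++ t) uu.2.
have [uu|t1 Ht1] := @dense_open_all T _ [seq (u, u') | u <- Q, u' <- Q] D1 [::].
  split=> [s t H sz|s].
    have [N' HN'] := H sz; exists N'; rewrite catA; exact: tail_small_catl.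
  have [sz|nsz] := eqVneq (size uu.1) (size uu.2); last first.
    by exists [::] => /eqP; rewrite (negPf nsz).
  have [t' [N' HN']] := tail_small_dense s e0 sz.
  by exists t' => _; exists N'.
have /choice[F HF] : forall uu : seq T * seq T, exists N', uu.1 \in Q -> uu.2 \in Q ->
    tail_small e N' (uu.1 ++ t1) uu.2.
  move=> [u u'] /=; have [/andP[uQ uQ']|] := boolP ((u \in Q) && (u' \in Q)).
    have [|N' HN'] := Ht1 (u, u') _ (sQ _ _ uQ uQ').
      by apply/allpairsP; exists (u, u').
    by exists N'.
  by move=> /negP nQ; exists 0%N => uQ uQ'; case: nQ; rewrite uQ.
pose N' := (N + \max_(uu <- [seq (u, u') | u <- Q, u' <- Q]) F uu).+1.
pose D2 (k : seq T * (nat + nat)) t := match k.2 with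
  | inl j => exists v, forall y, generic O y -> inn (k.1 ++ t) y -> th y j = v
  | inr n => O n (k.1 ++ t) end.
have [k|t2 Ht2] := @dense_open_all T _
    ([seq (u, k) | u <- Q, k <- [seq inl j | j <- iota 0 N'] ++ [seq inr n | n <- iota 0 i]])
    D2 t1.
  case: k => u [j|n]; last exact: (@dense_open_shift T (O n)).
  split=> [s t [v Hv]|s].
    by exists v => y Oy; rewrite catA => /inn_catl; exact: Hv.
  have [y uy Oy] := baire_seq t0 (u ++ s) dO.
  have [m Hm] := th_cont Oy j.
  have [t yt] : exists t, mkseq y (maxn (size (u ++ s)) m) = (u ++ s) ++ t.
    exact: inn_mkseq_cat uy (leq_maxl _ _).
  exists t, (th y j) => y' Oy'; rewrite /= catA -yt => yy'.
  apply/esym/Hm => // l lm; have {}lm := leq_trans lm (leq_maxr (size (u ++ s)) _).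
  by rewrite -yy' ?nth_mkseq ?size_mkseq.
exists (t1 ++ t2), N'; split.
- by rewrite ltnS leq_addr.
- move=> u u' uQ uQ'; rewrite catA; apply: tail_small_catl.
  apply: tail_small_le (HF (u, u') uQ uQ'); apply: leqW; apply: leq_trans (leq_addl _ _).
  by apply: leq_bigmax_seq => //; apply/allpairsP; exists (u, u').
- move=> u uQ j jN; apply: (Ht2 (u, inl j)); apply/allpairsP; exists (u, inl j).
  by split=> //; rewrite mem_cat; apply/orP; left; apply/mapP; exists j; rewrite ?mem_iota.
- move=> u uQ n ni; apply: (Ht2 (u, inr n)); apply/allpairsP; exists (u, inr n).
  by split=> //; rewrite mem_cat; apply/orP; right; apply/mapP; exists n; rewrite ?mem_iota.
Qed.

Hypothesis g_refl : forall j a, g j a a = 0.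

(* [hat x] carries the free coordinates [x i] at the positions [q i] and fixed
   entries elsewhere; [d] is a default choice of the free coordinates. *)
Lemma additive_form (vals : nat -> seq T) (P : nat -> nat -> Prop) (e : nat -> R)
    (d : nat -> T) :
  (forall i, 0 < e i) -> (forall i m, exists2 n, (m <= n)%N & P i n) ->
  (forall i, d i \in vals i) ->
  exists (q N : nat -> nat) (hat : (nat -> T) -> (nat -> T)),
    [/\ forall i, (q i < q i.+1)%N /\ P i (q i),
        N 0%N = 0%N /\ forall i, (N i < N i.+1)%N,
        forall x i, hat x (q i) = x i,
        forall x y n, (forall i, n <> q i) -> hat x n = hat y n &
        forall x, (forall i, x i \in vals i) -> forall i,
          \sum_(N i <= j < N i.+1)
            g j (th (hat x) j) (th (hat (fun k => if k == i then x i else d k)) j)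
          <= e i].
Proof.
move=> e0 exP dvals.
(* The prefixes obtained by padding up to the next free position and putting any allowed value
   there. *)
pose Q1 i (Q : seq (seq T)) pad := [seq u ++ pad ++ [:: v] | u <- Q, v <- vals i].
have /choice[f Hf] : forall k : nat * (seq (seq T) * nat * nat),
    exists r : seq T * seq T * nat,
    let i := k.1 in let Q := k.2.1.1 in let L := k.2.1.2 in let N := k.2.2 in
    let pad := r.1.1 in let t := r.1.2 in let N' := r.2 in
    {in Q, forall u, size u = L} ->
    P i (L + size pad)%N /\ [/\ (N < N')%N,
    {in Q1 i Q pad &, forall u u', tail_small (e i.+1) N' (u ++ t) u'},
    {in Q1 i Q pad, forall u, forall j, (j < N')%N -> exists v, forall y,
      generic O y -> inn (u ++ t) y -> th y j = v} &
    {in Q1 i Q pad, forall u, forall n, (n < i)%N -> O n (u ++ t)}].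
  move=> [i [[Q L] N]] /=; have [n Ln Pn] := exP i L.
  have [sQ|nsQ] := pselect {in Q, forall u, size u = L}; last by exists ([::], [::], 0%N).
  have [|t [N' H]] := @stage i N (Q1 i Q (nseq (n - L) t0)) (e i.+1) (e0 _).
    move=> _ _ /allpairsP[[u v] [/= uQ _ ->]] /allpairsP[[u' v'] [/= uQ' _ ->]].
    by rewrite !size_cat/= (sQ _ uQ) (sQ _ uQ').
  by exists (nseq (n - L) t0, t, N') => _ /=; rewrite size_nseq subnKC.
(* The state at stage [i]: the finite list of all possible prefixes, their common length, and the
   bound [N i] below which the outputs are decided. *)
pose st := fix st i : seq (seq T) * nat * nat := if i is k.+1 then
  let s := st k in let r := f (k, s) in
  ([seq w ++ r.1.2 | w <- Q1 k s.1.1 r.1.1],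
   (s.1.2 + size r.1.1 + 1 + size r.1.2)%N, r.2) else ([:: [::]], 0%N, 0%N).
pose Q i := (st i).1.1; pose L i := (st i).1.2; pose N i := (st i).2.
pose pad i := (f (i, st i)).1.1; pose t i := (f (i, st i)).1.2.
have sQ i : {in Q i, forall u, size u = L i}.
  elim: i => [u|i IHi u]; first by rewrite inE => /eqP ->.
  move=> /mapP[_ /allpairsP[[w v] [wQ _ ->]] ->].
  by rewrite !size_cat/= IHi// addnA.
have {}Hf i := Hf (i, st i) (sQ i).
pose pre x := fix pre i := if i is k.+1 then (pre k ++ pad k ++ [:: x k]) ++ t k else [::].
have size_pre x i : size (pre x i) = L i.
  by elim: i => // i IHi; rewrite /= !size_cat IHi /= addnA.
have pre_ext x y k : (forall l, (l < k)%N -> x l = y l) -> pre x k = pre y k.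
  elim: k => // k IHk xy; rewrite /= IHk ?xy// => l lk.
  by apply: xy; exact: ltnW.
have preQ1 x i : (forall i, x i \in vals i) -> pre x i ++ pad i ++ [:: x i] \in
    Q1 i (Q i) (pad i).
  move=> xv; have QQ1 k : pre x k \in Q k -> pre x k ++ pad k ++ [:: x k] \in
      Q1 k (Q k) (pad k) by move=> ?; apply/allpairsP; exists (pre x k, x k); split=> //=.
  apply: (QQ1); elim: i => [|i IHi]; first by rewrite inE.
  exact/map_f/QQ1.
pose hat x n := nth t0 (pre x n.+1) n.
have hat_inn x n : inn (pre x n) (hat x).
  apply: (@seq_limit _ t0 (pre x) (fun k => (pad k ++ [:: x k]) ++ t k)) => k.
    by rewrite /= -!catA.
  by rewrite !size_cat addn1.
pose q i := (L i + size (pad i))%N.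
have qL i : (q i < L i.+1)%N by rewrite /q {2}/L /= addn1 ltn_addr.
have q_incr i : (q i < q i.+1)%N by apply: leq_trans (qL i) _; rewrite leq_addr.
have q_mono i k : (i <= k)%N -> (q i <= q k)%N.
  elim: k => [|k IHk]; first by rewrite leqn0 => /eqP ->.
  rewrite leq_eqVlt => /predU1P[->//|]; rewrite ltnS => /IHk/leq_trans; apply.
  exact: ltnW.
have hat_loc x y n : (forall i, n = q i -> x i = y i) -> hat x n = hat y n.
  move=> xy; suff H k : nth t0 (pre x k) n = nth t0 (pre y k) n by rewrite /hat H.
  elim: k => // k IHk; rewrite /= -!catA !nth_cat !size_pre.
  case: ltnP => // Ln; case: ltnP => // pn /=.
  case E : (n - L k - size (pad k))%N => [|m]//=; apply: xy.
  by rewrite /q; move: Ln pn E; lia.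
have hat_gen x : (forall i, x i \in vals i) -> generic O (hat x).
  move=> xv n; exists (size (pre x n.+2)).
  have /inn_mkseq -> := hat_inn x n.+2.
  by have [_ [_ _ _]] := Hf n.+1; apply; [exact: preQ1|].
have hat_dec x y i : (forall i, x i \in vals i) -> (forall i, y i \in vals i) ->
    (forall l, (l <= i)%N -> x l = y l) ->
    forall j, (j < N i.+1)%N -> th (hat x) j = th (hat y) j.
  move=> xv yv xy j jN; have [_ [_ _ H _]] := Hf i.
  have [v Hv] := H _ (preQ1 x i xv) j jN.
  have xi : inn ((pre x i ++ pad i ++ [:: x i]) ++ t i) (hat x).
    exact: (hat_inn x i.+1).
  have yi : inn ((pre x i ++ pad i ++ [:: x i]) ++ t i) (hat y).
    have -> : (pre x i ++ pad i ++ [:: x i]) ++ t i = pre y i.+1.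
      exact: (@pre_ext x y i.+1).
    exact: hat_inn.
  by rewrite (Hv _ (hat_gen x xv) xi) (Hv _ (hat_gen y yv) yi).
exists q, N, hat; split.
- by move=> i; split=> //; case: (Hf i).
- by split=> // i; case: (Hf i) => _ [].
- move=> x i; rewrite -(hat_inn x i.+1) ?size_pre//= -!catA nth_cat size_pre.
  by rewrite ltnNge leq_addr/= addKn nth_cat ltnn subnn.
- by move=> x y n nq; apply: hat_loc => i /nq.
move=> x xv i; pose x' k := if k == i then x i else d k.
have x'v k : x' k \in vals k by rewrite /x'; case: eqP => [->|].
rewrite -/x'; case: i => [|i] in x' x'v *.
  rewrite big_nat big1 ?ltW// => j /andP[_ jN].
  rewrite (@hat_dec x x' 0)// => l; rewrite leqn0 => /eqP ->.
  by rewrite /x' eqxx.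
(* [x2] shares its tail with [x], so by [tail_small] their outputs from [N i.+1] on are within
   [e i.+1]; it agrees with [x'] up to free coordinate [i.+1], so their outputs below [N i.+2]
   coincide. *)
pose x2 l := if (l < i.+1)%N then d l else x l.
have x2v k : x2 k \in vals k by rewrite /x2; case: ifP.
have [_ [_ + _ _]] := Hf i; move=> /(_ _ _ (preQ1 x i xv) (preQ1 x2 i x2v)).
move=> /(_ (hat x) (hat x2) (hat_gen x xv) (hat_gen x2 x2v)).
have -> : (pre x i ++ pad i ++ [:: x i]) ++ t i = pre x i.+1 by [].
move=> /(_ (hat_inn x i.+1)).
have x2i : inn (pre x2 i ++ pad i ++ [:: x2 i]) (hat x2).
  by apply: (@inn_catl _ _ _ (t i)); exact: (hat_inn x2 i.+1).
move=> /(_ x2i) H; apply: le_trans (H _ (N i.+2)).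
  rewrite !big_nat; apply: ler_sum => j /andP[_ jN].
  rewrite (@hat_dec x2 x' i.+1)// => l li; rewrite /x2 /x'.
  by case: ltngtP li => // ->.
move=> n; rewrite !size_cat size_pre /= => qn; apply: hat_loc => l nl.
rewrite /x2; case: ifP => //; rewrite ltnS => /q_mono.
by rewrite -nl leqNgt /q -addn1 -addnA qn.
Qed.

End additive.
(** * The relations *)

Section powers.
Context {R : realType}.
Implicit Types (e a b : R).

(** The sum is at most twice the larger summand; the factor serves all exponents up to [p] at
    once. *)
Lemma powR_quasi_triangle p e a b : 0 <= e <= p -> 0 <= a -> 0 <= b ->
  (a + b) `^ e <= 2 `^ p * (a `^ e + b `^ e).
Proof.
move=> /andP[e0 ep]; wlog ab : a b / a <= b.
  by move=> H a0 b0; have [|/ltW] := leP a b => /H; [|rewrite addrC (addrC (a `^ _))]; exact.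
move=> a0 b0; apply: (@le_trans _ _ ((2 * b) `^ e)).
  by apply: ge0_ler_powR; rewrite ?nnegrE ?addr_ge0 ?mulr_ge0//; lra.
rewrite powRM//; apply: ler_pM; rewrite ?powR_ge0//.
  by apply: ler_powR => //; lra.
by rewrite lerDr powR_ge0.
Qed.

Lemma powR_ge1 a e : 1 <= a -> 0 <= e -> 1 <= a `^ e.
Proof. by move=> a1 e0; rewrite -[leLHS](powRr0 a) ler_powR. Qed.

(** The power mean inequality. With [A] the mean, Young's inequality bounds t_m A^(e-1) by t_m^e / e
    + A^e / e', where e' = e/(e-1); summing over m gives n A^e <= sum of the t_m^e. *)
Lemma powR_sum_le n (t : nat -> R) e : 1 <= e -> (forall m, 0 <= t m) ->
  (\sum_(0 <= m < n) t m) `^ e <= n%:R `^ (e - 1) * \sum_(0 <= m < n) t m `^ e.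
Proof.
move=> e1 t0; have e0 : 0 < e by lra.
case: n => [|n]; first by rewrite !big_geq// powR0 ?mulr0// gt_eqF.
move: e1; rewrite le_eqVlt => /predU1P[<-|e1].
  rewrite subrr powRr0 mul1r powRr1 ?sum_nat_ge0//.
  by under eq_bigr => m _ do rewrite -(powRr1 (t0 m)).
set S := \sum_(0 <= m < n.+1) t m; pose A := S / n.+1%:R.
have S0 : 0 <= S by exact: sum_nat_ge0.
have A0 : 0 <= A by rewrite divr_ge0.
have SE : S = n.+1%:R * A by rewrite /A mulrCA mulfV ?mulr1// pnatr_eq0.
suff H : n.+1%:R * A `^ e <= \sum_(0 <= m < n.+1) t m `^ e.
  rewrite SE powRM// -(mulr_powRB1 (x := n.+1%:R))// mulrAC -mulrA mulrC.
  by rewrite (mulrC (A `^ e)) -mulrA ler_wpM2l ?powR_ge0// mulrC.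
have young m : t m * A `^ (e - 1) <= t m `^ e / e + A `^ e / (e / (e - 1)).
  have -> : A `^ e = (A `^ (e - 1)) `^ (e / (e - 1)).
    by rewrite -powRrM; congr (_ `^ _); field; lra.
  apply: conjugate_powR; rewrite ?powR_ge0//; first by rewrite divr_gt0//; lra.
  by field; apply/andP; split; lra.
have : \sum_(0 <= m < n.+1) t m * A `^ (e - 1) <=
    \sum_(0 <= m < n.+1) (t m `^ e / e + A `^ e / (e / (e - 1))).
  by apply: ler_sum => m _; exact: young.
rewrite -mulr_suml -/S SE -mulrA mulr_powRB1// big_split/= -mulr_suml.
rewrite big_const_nat subn0 iter_addr_0 -(mulr_natl (_ / _)).
set X := n.+1%:R * A `^ e; set Y := \sum_(_ <= _ < _) _ => H.
have -> : Y = e * (Y / e + n.+1%:R * (A `^ e / (e / (e - 1)))) - (e - 1) * X.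
  by rewrite /X; field; apply/andP; split; lra.
by have := ler_wpM2l (ltW e0) H; set W := Y / e + _; lra.
Qed.

End powers.

(** * Weights, exponents and the relations [Erel] *)

Section costs.
Context (R : realType) (p : R).
Hypothesis p1 : 1 <= p.
Implicit Types (U V : set nat) (a b c : int).

Definition pexp (k : nat) : R := p + k.+1%:R^-1.

(* The size of the grid of type [k] is such that
   [gsize k `^ (pexp k - pexp k.+1) = k + 1]. *)
Definition gsize (k : nat) : nat := (k.+1 ^ (k.+1 * k.+2))%N.

(** The factors [l.+1] yield [alpha_lt]; together with the powers of [gsize l] they keep the cost
    alpha_k N^(p_k), for N = [gsize k], below 1/(k+1), as p_k <= p + 1. *)
Definition alpha (k : nat) : R :=
  \prod_(l < k.+1) (l.+1%:R * (gsize l)%:R `^ (p + 1))^-1.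

(* [0] is the type of the coordinates coding [l_p], and [k.+1] that of the
   coordinates attached to [k]. *)
Definition typ (n : nat) : nat := logn 2 n.+1.

Definition weight U (n : nat) : R :=
  if typ n is k.+1 then (if `[< U k >] then alpha k else 1) else (2^-1 ^+ n) `^ p.

Definition expo U (n : nat) : R :=
  if typ n is k.+1 then (if `[< U k >] then pexp k else p) else p.

Definition zdist a b : R := `|a%:~R - b%:~R|.

Definition cost (w e : nat -> R) (n : nat) a b : R := w n * zdist a b `^ e n.

Definition Erel (w e : nat -> R) (x y : seqspace int) : Prop :=
  bsum (fun n => cost w e n (x n) (y n)).

Lemma pexp_gt k : p < pexp k.
Proof. by rewrite ltrDl invr_gt0. Qed.

Lemma pexp_le k : pexp k <= p + 1.
Proof. by rewrite lerD2l invf_le1// ler1n. Qed.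

Lemma pexp_mono k l : (k <= l)%N -> pexp l <= pexp k.
Proof. by move=> kl; rewrite lerD2l lef_pV2 ?posrE// ler_nat. Qed.

Lemma gsize_gt0 k : (0 < gsize k)%N.
Proof. by rewrite expn_gt0. Qed.

(** The difference p_k - p_(k+1) = 1/((k+1)(k+2)) cancels the exponent in [gsize]. The gain of the
    factor k+1 is what will tell type k apart from exponents up to p_(k+1). *)
Lemma gsize_powR k : (gsize k)%:R `^ pexp k = (gsize k)%:R `^ pexp k.+1 * k.+1%:R :> R.
Proof.
have -> : pexp k = pexp k.+1 + ((k.+1 * k.+2)%:R)^-1.
  rewrite /pexp natrM; field.
  by rewrite nat1r; apply/andP; split; rewrite lt0r_neq0// ?ltr0n//; lra.
rewrite powRD; last by apply/implyP => _; rewrite pnatr_eq0 -lt0n gsize_gt0.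
congr (_ * _); rewrite /gsize natrX -powR_mulrn// -powRrM.
by rewrite mulfV ?powRr1// pnatr_eq0.
Qed.

Lemma alpha_factor_ge1 l : 1 <= l.+1%:R * (gsize l)%:R `^ (p + 1) :> R.
Proof.
rewrite -[leLHS]mulr1 ler_pM// ?ler1n//.
by apply: powR_ge1; [rewrite ler1n gsize_gt0|rewrite addr_ge0// (le_trans ler01)].
Qed.

Lemma alpha_gt0 k : 0 < alpha k.
Proof.
apply: prodr_gt0 => l _; rewrite invr_gt0.
exact: lt_le_trans ltr01 (alpha_factor_ge1 l).
Qed.

Lemma alphaS k :
  alpha k.+1 = alpha k * (k.+2%:R * (gsize k.+1)%:R `^ (p + 1))^-1.
Proof. by rewrite /alpha big_ord_recr. Qed.

Lemma alpha_le k l : (k <= l)%N -> alpha l <= alpha k.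
Proof.
elim: l => [|l IHl]; first by rewrite leqn0 => /eqP ->.
rewrite leq_eqVlt => /predU1P[->//|]; rewrite ltnS => /IHl; apply: le_trans.
rewrite alphaS ler_piMr ?(ltW (alpha_gt0 _))// invf_le1 ?alpha_factor_ge1//.
exact: lt_le_trans ltr01 (alpha_factor_ge1 _).
Qed.

Lemma alpha_lt k l : (l < k)%N -> k.+1%:R * alpha k <= alpha l.
Proof.
case: k => // k; rewrite ltnS => /alpha_le; apply: le_trans.
rewrite alphaS mulrCA ler_piMr ?(ltW (alpha_gt0 _))//.
rewrite invfM mulrA mulfV ?mul1r ?pnatr_eq0// invf_le1.
  by apply: powR_ge1; [rewrite ler1n gsize_gt0|rewrite addr_ge0// (le_trans ler01)].
by rewrite powR_gt0// ltr0n gsize_gt0.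
Qed.

Lemma alpha_gsize k : alpha k * (gsize k)%:R `^ pexp k <= k.+1%:R^-1.
Proof.
apply: (@le_trans _ _ (alpha k * (gsize k)%:R `^ (p + 1))).
  rewrite ler_wpM2l ?(ltW (alpha_gt0 _))// ler_powR ?pexp_le//.
  by rewrite ler1n gsize_gt0.
have g0 : 0 < (gsize k)%:R `^ (p + 1) :> R by rewrite powR_gt0// ltr0n gsize_gt0.
have H : (k.+1%:R * (gsize k)%:R `^ (p + 1))^-1 * (gsize k)%:R `^ (p + 1) = k.+1%:R^-1 :> R.
  by rewrite invfM -mulrA mulVf ?mulr1// gt_eqF.
rewrite -[leRHS]H ler_wpM2r ?(ltW g0)//.
rewrite /alpha big_ord_recr/= ler_piMl//.
apply: prodr_ile1 => l _; rewrite invr_ge0 mulr_ge0 ?powR_ge0//=.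
rewrite invf_le1 ?alpha_factor_ge1//.
exact: lt_le_trans ltr01 (alpha_factor_ge1 _).
Qed.

Lemma weight_gt0 U n : 0 < weight U n.
Proof.
rewrite /weight; case: (typ n) => [|k]; last by case: ifP; rewrite ?alpha_gt0.
by rewrite powR_gt0// exprn_gt0// invr_gt0.
Qed.

Lemma expo_bound U n : p <= expo U n <= p + 1.
Proof.
rewrite /expo; case: (typ n) => [|k]; first by rewrite lexx; lra.
by case: ifP => _; rewrite ?pexp_le ?(ltW (pexp_gt _))// lexx; lra.
Qed.

Lemma typ_cofinal k m : exists2 n, (m <= n)%N & typ n = k.
Proof.
(* [typ n] is the 2-adic valuation of n+1, hence k when n+1 = 2^k (2m+1). *)
exists (2 ^ k * m.*2.+1).-1; last first.
  rewrite /typ prednK ?muln_gt0 ?expn_gt0// lognM ?expn_gt0// pfactorK//.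
  by rewrite lognE dvdn2/= odd_double/= addn0.
rewrite -ltnS prednK ?muln_gt0 ?expn_gt0//.
apply: (@leq_trans m.*2.+1); last by rewrite leq_pmull// expn_gt0.
by rewrite ltnS -addnn leq_addr.
Qed.

Lemma zdist_ge0 a b : 0 <= zdist a b.
Proof. exact: normr_ge0. Qed.

Lemma zdist_refl a : zdist a a = 0.
Proof. by rewrite /zdist subrr normr0. Qed.

Lemma zdist_sym a b : zdist a b = zdist b a.
Proof. by rewrite /zdist distrC. Qed.

Lemma zdist_triangle a b c : zdist a c <= zdist a b + zdist b c.
Proof. exact: ler_distD. Qed.

Lemma zdist_succ (m : nat) : zdist m m.+1 = 1.
Proof. by rewrite /zdist distrC -intrB -add1n PoszD addrK normr1. Qed.

Lemma zdist_ge1 a b : a != b -> 1 <= zdist a b.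
Proof.
move=> ab; rewrite /zdist -intrB -intr_norm ler1z -gtz0_ge1 normr_gt0.
by rewrite subr_eq0.
Qed.

Section cost.
Variables (w e : nat -> R).
Hypothesis w0 : forall n, 0 < w n.
Hypothesis e0 : forall n, 1 <= e n <= p + 1.

Let e_gt0 n : 0 < e n.
Proof. by have /andP[] := e0 n; lra. Qed.

Lemma cost_ge0 n a b : 0 <= cost w e n a b.
Proof. by rewrite mulr_ge0 ?powR_ge0// ltW. Qed.

Lemma cost_refl n a : cost w e n a a = 0.
Proof. by rewrite /cost zdist_refl powR0 ?mulr0// gt_eqF. Qed.

Lemma cost_sym n a b : cost w e n a b = cost w e n b a.
Proof. by rewrite /cost zdist_sym. Qed.

Lemma cost_quasi_triangle n a b c :
  cost w e n a c <= 2 `^ (p + 1) * (cost w e n a b + cost w e n b c).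
Proof.
rewrite /cost -mulrDr mulrCA ler_wpM2l ?(ltW (w0 _))//.
have [e1 ep] := andP (e0 n).
apply: le_trans (powR_quasi_triangle _ (zdist_ge0 a b) (zdist_ge0 b c)).
  by rewrite ge0_ler_powR ?nnegrE ?addr_ge0 ?zdist_ge0 ?zdist_triangle// ltW.
by rewrite (ltW (e_gt0 n)).
Qed.

Lemma cost_ge_weight n a b : a != b -> w n <= cost w e n a b.
Proof.
move=> ab; rewrite ler_peMr ?(ltW (w0 _))//.
by rewrite powR_ge1 ?zdist_ge1// ltW.
Qed.

Lemma equivalence_Erel : Equivalence (Erel w e).
Proof.
split.
- by move=> x; exists 0 => n; rewrite big1// => i _; rewrite cost_refl.
- by move=> x y; apply: bsum_le => n; rewrite cost_sym.
move=> x y z xy yz; apply: (@bsum_le _ _ (fun n => 2 `^ (p + 1) *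
    (cost w e n (x n) (y n) + cost w e n (y n) (z n)))).
  by move=> n; exact: cost_quasi_triangle.
by apply: bsumZ; rewrite ?powR_ge0//; exact: bsumD.
Qed.

Lemma borel_Erel : borel_relation (Erel w e).
Proof.
rewrite /borel_relation.
have -> : [set xy : seqspace int * seqspace int | Erel w e xy.1 xy.2] =
    \bigcup_M \bigcap_N [set xy : seqspace int * seqspace int |
      \sum_(0 <= n < N) cost w e n (xy.1 n) (xy.2 n) <= M%:R].
  apply/seteqP; split=> [xy [M HM]|xy [M _ HM]]; last first.
    by exists M%:R => N; exact: HM.
  exists (Num.bound `|M|) => // N _ /=; apply: le_trans (HM N) _.
  by apply: le_trans (ler_norm _) _; apply/ltW/archi_boundP.
apply: borel_bigcup => M; apply: borel_bigcap => N; apply: borel_open.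
apply: (@open_seqspace2 _ _ N) => x y x' y' xx' yy' /=; apply: le_trans.
rewrite !big_nat; apply: ler_sum => n /andP[_ nN].
by rewrite xx'// yy'.
Qed.

End cost.

End costs.
(** * Irreducibility *)

Section rigidity.
Context (R : realType) (p : R).
Hypothesis p1 : 1 <= p.
Implicit Types (U V : set nat).

(** The triangle inequality along the path, followed by the power mean inequality. *)
Lemma path_rigid (w e : nat -> R) (e' : R) (n N : nat) (T : nat -> int) :
  0 < w n -> 1 <= e n <= e' -> (0 < N)%N ->
  cost w e n (T 0%N) (T N) <= N%:R `^ (e' - 1) *
    \sum_(0 <= m < N) cost w e n (T m) (T m.+1).
Proof.
move=> w0 /andP[e1 ee'] N0.
have tri : zdist R (T 0%N) (T N) <= \sum_(0 <= m < N) zdist R (T m) (T m.+1).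
  elim: N {N0} => [|N IHN]; first by rewrite big_geq// zdist_refl.
  by rewrite big_nat_recr//=; apply: le_trans (zdist_triangle _ _ (T N) _) _; rewrite lerD2r.
rewrite /cost -mulr_sumr mulrCA ler_wpM2l ?(ltW w0)//.
apply: (@le_trans _ _ ((\sum_(0 <= m < N) zdist R (T m) (T m.+1)) `^ e n)).
  apply: ge0_ler_powR; rewrite ?nnegrE ?zdist_ge0 ?sumr_ge0//.
    by apply: le_trans e1.
  by move=> m _; exact: zdist_ge0.
apply: le_trans (powR_sum_le N e1 _) _ => [m|]; first exact: zdist_ge0.
rewrite ler_wpM2r ?sumr_ge0// => [m _|]; first exact: powR_ge0.
by rewrite ler_powR ?ler1n// lerD2r.
Qed.

(** Distinct integers cost at least [w n], so a cheaper step does not move. *)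
Lemma path_constant (w e : nat -> R) (n N : nat) (T : nat -> int) :
  (forall m, 0 < w m) -> (forall m, 1 <= e m <= p + 1) ->
  (forall m, (m < N)%N -> cost w e n (T m) (T m.+1) < w n) -> T 0%N = T N.
Proof.
move=> w0 e1; elim: N => // N IHN H; rewrite IHN => [|m mN]; last first.
  by apply: H; exact: ltnW.
apply: contrapT => /eqP ne; have := cost_ge_weight w0 e1 n ne.
by rewrite leNgt H.
Qed.

(** Coordinates of weight at least [delta] are frozen by [path_constant]: those attached to some l <
    k in [V] and those attached to a number outside [V], in particular to k. All others have
    exponent at most p_(k+1), so [path_rigid] applies, and summing over the [gsize k] steps adds one
    factor [gsize k]. *)
Lemma block_rigid V k (T : nat -> nat -> int) (N N' : nat) (delta : R) : ~ V k ->
  delta <= k.+1%:R * alpha p k -> (0 < k)%N ->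
  (forall m, (m < gsize k)%N ->
    \sum_(N <= j < N') cost (weight p V) (expo p V) j (T m j) (T m.+1 j) < delta) ->
  \sum_(N <= j < N') cost (weight p V) (expo p V) j (T 0%N j) (T (gsize k) j) <=
    (gsize k)%:R `^ pexp p k.+1 * delta.
Proof.
move=> nVk dk k0 Td.
set c := cost _ _; have w0 := weight_gt0 p1 V; have e0 := expo_bound p V.
have e1 n : 1 <= expo p V n <= p + 1.
  by have /andP[pe ->] := e0 n; rewrite (le_trans p1 pe).
have c0 j a b : 0 <= c j a b by exact: (cost_ge0 _ w0).
have cd m j : (m < gsize k)%N -> (N <= j < N')%N -> c j (T m j) (T m.+1 j) < delta.
  move=> mk jN; apply: le_lt_trans (Td m mk); rewrite (bigD1_seq j) ?iota_uniq//=; last first.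
    by rewrite mem_index_iota.
  by rewrite lerDl sumr_ge0.
have cj j : (N <= j < N')%N -> c j (T 0%N j) (T (gsize k) j) <=
    (gsize k)%:R `^ (pexp p k.+1 - 1) *
      \sum_(0 <= m < gsize k) c j (T m j) (T m.+1 j).
  move=> jN.
  have const : delta <= weight p V j -> T 0%N j = T (gsize k) j.
    move=> dw; apply: (@path_constant (weight p V) (expo p V) j _ (T ^~ j)) => // m mk.
    exact: lt_le_trans (cd m j mk jN) dw.
  have rigid : expo p V j <= pexp p k.+1 -> c j (T 0%N j) (T (gsize k) j) <=
    (gsize k)%:R `^ (pexp p k.+1 - 1) * \sum_(0 <= m < gsize k) c j (T m j) (T m.+1 j).
    move=> ek; apply: (@path_rigid (weight p V) (expo p V) _ j (gsize k) (T ^~ j)) => //.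
      by rewrite ek; have /andP[-> _] := e1 j.
    exact: gsize_gt0.
  have triv : delta <= weight p V j -> c j (T 0%N j) (T (gsize k) j) <=
    (gsize k)%:R `^ (pexp p k.+1 - 1) * \sum_(0 <= m < gsize k) c j (T m j) (T m.+1 j).
    move=> /const ->; rewrite /c (cost_refl _ e1).
    by rewrite mulr_ge0 ?powR_ge0// sumr_ge0// => m _; exact: c0.
  move: triv rigid {const}; rewrite /weight /expo; case: (typ j) => [_|l].
    by apply; rewrite ltW// pexp_gt.
  have kl1 l' : (l' < k)%N -> delta <= alpha p l'.
    by move=> lk; apply: le_trans dk _; exact: alpha_lt.
  case: ifPn => [/asboolP Vl|_] triv rigid.
    have [lk|kl|lk] := ltngtP l k.
    - exact/triv/kl1.
    - by apply: rigid; exact: pexp_mono.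
    - by move: Vl; rewrite lk.
  (* As 0 < k, [delta] is at most [alpha 0], hence at most the weight 1. *)
  apply: triv; apply: le_trans (kl1 0%N k0) _.
  rewrite /alpha big_ord1 invf_le1 ?alpha_factor_ge1//.
  exact: lt_le_trans ltr01 (alpha_factor_ge1 p1 _).
apply: (@le_trans _ _ (\sum_(N <= j < N') (gsize k)%:R `^ (pexp p k.+1 - 1) *
      \sum_(0 <= m < gsize k) c j (T m j) (T m.+1 j))).
  by rewrite !big_nat; apply: ler_sum => j jN; exact: cj.
rewrite -mulr_sumr exchange_big/=.
have g0 : 0 < (gsize k)%:R :> R by rewrite ltr0n gsize_gt0.
apply: (@le_trans _ _ ((gsize k)%:R `^ (pexp p k.+1 - 1) *
    \sum_(0 <= m < gsize k) delta)).
  rewrite ler_wpM2l ?powR_ge0// !big_nat; apply: ler_sum => m /andP[_ mk].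
  exact/ltW/Td.
rewrite big_const_nat subn0 iter_addr_0 -(mulr_natl delta) mulrA.
rewrite (mulrC (_ `^ _)) mulr_powRB1//.
by apply: lt_trans (pexp_gt p k.+1); apply: lt_le_trans p1.
Qed.

(** Choices with small [u]-value and much larger [v]-value are collected until the [v]-sum of a
    block reaches 1, which happens because each contributes at least [c]. The [u]-sum of the block
    is then at most 2/K, and K doubles from block to block. *)
Lemma greedy_separation (A : Type) (a0 : A) (u v : nat -> A -> R)
    (P : nat -> A -> Prop) :
  (forall i, P i a0 /\ u i a0 = 0 /\ v i a0 = 0) ->
  (forall i a, 0 <= u i a) -> (forall i a, 0 <= v i a) ->
  (forall K : R, 0 < K -> exists2 c, 0 < c & forall i0, exists i a, [/\ (i0 <= i)%N,
     P i a, K * u i a <= v i a, u i a <= K^-1 & c <= v i a]) ->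
  exists s : nat -> A, [/\ forall i, P i (s i), bsum (fun i => u i (s i)) &
    ~ bsum (fun i => v i (s i))].
Proof.
move=> a00 u0 v0 H.
have block K i0 : 0 < K -> exists (i1 : nat) (s : nat -> A), [/\ (i0 < i1)%N,
    forall i, P i (s i), \sum_(i0 <= i < i1) u i (s i) <= 2 / K &
    1 <= \sum_(i0 <= i < i1) v i (s i)].
  move=> K0; have [c c0 Hc] := H K K0.
  (* After [n] choices either the block is complete, or its [v]-sum is at least [n * c], still below
     1, and at least [K] times its [u]-sum. *)
  have step n : exists (i1 : nat) (s : nat -> A), (i0 <= i1)%N /\
      (forall i, P i (s i)) /\
      let Su := \sum_(i0 <= i < i1) u i (s i) in
      let Sv := \sum_(i0 <= i < i1) v i (s i) in
      (Su <= 2 / K /\ 1 <= Sv) \/ [/\ n%:R * c <= Sv, Sv < 1 & K * Su <= Sv].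
    elim: n => [|n [i1 [s [i01 [Ps []]]]]].
    - exists i0, (fun=> a0); split=> //; split=> [i|]; first exact: (a00 i).1.
      by right; rewrite !big_geq// mulr0 mul0r.
    - by move=> ok; exists i1, s; split=> //; split=> //; left.
    move=> [nS S1 KS]; have [i [a [ii Pa Ka aK ca]]] := Hc i1.
    pose s' k := if (k < i1)%N then s k else if k == i then a else a0.
    have sumE (f : nat -> A -> R) : (forall k, f k a0 = 0) ->
        \sum_(i0 <= k < i.+1) f k (s' k) = \sum_(i0 <= k < i1) f k (s k) + f i a.
      move=> fa0; rewrite big_nat_recr/=; last exact: leq_trans ii.
      rewrite (big_cat_nat i01 ii)/= {3}/s' ltnNge ii eqxx/=; congr (_ + _).
      rewrite [X in _ + X]big_nat [X in _ + X]big1 ?addr0 => [|k /andP[ik ki]].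
        by rewrite !big_nat; apply: eq_bigr => k /andP[_ ki]; rewrite /s' ki.
      by rewrite /s' ltnNge ik/= ltn_eqF.
    exists i.+1, s'; split; first by apply: leq_trans i01 (leqW ii).
    split=> [k|].
      by rewrite /s'; case: ifP => // _; case: eqP => [->//|_]; exact: (a00 k).1.
    rewrite /= !sumE; last 2 first.
    - by move=> k; have [_ []] := a00 k.
    - by move=> k; have [_ []] := a00 k.
    set Su := \sum_(_ <= _ < _) _ in KS *; set Sv := \sum_(_ <= _ < _) _ in nS S1 KS *.
    have [lt1|ge1] := ltP (Sv + v i a) 1; [right; split=> //|left; split=> //].
    + by rewrite -natr1 mulrDl mul1r lerD.
    + by rewrite mulrDr lerD.
    (* Before the last choice the [v]-sum was below 1, so the [u]-sum was at most 1/K; the last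
       choice adds at most 1/K. *)
    have SuK : Su <= K^-1.
      by rewrite -(ler_pM2l K0) mulfV ?gt_eqF// (le_trans KS)// ltW.
    by rewrite (_ : 2 / K = K^-1 + K^-1) ?lerD//; field; rewrite gt_eqF.
  have [n nc] : exists n : nat, 1 < n%:R * c.
    exists (Num.bound `|c^-1|); rewrite -ltr_pdivrMr// mul1r.
    by apply: le_lt_trans (ler_norm _) _; apply: archi_boundP.
  have [i1 [s [i01 [Ps []]]]] := step n.
    move=> [Su Sv]; exists i1, s; split=> //; rewrite ltn_neqAle i01 andbT.
    by apply/eqP => i01'; move: Sv; rewrite i01' big_geq// ler10.
  by move=> [nS S1 _]; have := lt_trans (lt_le_trans nc nS) S1; rewrite ltxx.
have K0 m : 0 < 2 * 2 ^+ m :> R by rewrite mulr_gt0 ?exprn_gt0.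
have /choice[f Hf] : forall mi : nat * nat, exists r : nat * (nat -> A), [/\ (mi.2 < r.1)%N,
    forall i, P i (r.2 i), \sum_(mi.2 <= i < r.1) u i (r.2 i) <= 2^-1 ^+ mi.1 &
    1 <= \sum_(mi.2 <= i < r.1) v i (r.2 i)].
  move=> [m i0]; have [i1 [s [? ? us vs]]] := block _ i0 (K0 m).
  exists (i1, s); split=> //=; apply: le_trans us _.
  by rewrite invfM mulrA mulfV ?mul1r ?exprVn.
pose e := fix e m := if m is k.+1 then (f (k, e k)).1 else 0%N.
have e_incr m : (e m < e m.+1)%N by have [] := Hf (m, e m).
have e_mono m n : (m <= n)%N -> (e m <= e n)%N.
  elim: n => [|n IHn]; first by rewrite leqn0 => /eqP ->.
  rewrite leq_eqVlt => /predU1P[->//|]; rewrite ltnS => /IHn/leq_trans; apply.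
  exact: ltnW.
have /choice[b Hb] : forall i, exists m, (e m <= i < e m.+1)%N.
  move=> i; have : exists m, (i < e m.+1)%N.
    exists i; elim: i => [|i IHi]; first exact: leq_ltn_trans (e_incr 0%N).
    exact: leq_ltn_trans IHi (e_incr _).
  move=> /ex_minnP[m im minm]; exists m; rewrite im andbT.
  case: m minm {im} => // m minm; rewrite leqNgt; apply/negP => /minm.
  by rewrite ltnn.
have bE i m : (e m <= i < e m.+1)%N -> b i = m.
  move=> /andP[mi im]; have /andP[bi ib] := Hb i.
  have [lt|gt|//] := ltngtP (b i) m.
  - by have := leq_trans (leq_trans ib (e_mono _ _ lt)) mi; rewrite ltnn.
  - by have := leq_trans (leq_trans im (e_mono _ _ gt)) bi; rewrite ltnn.
exists (fun i => (f (b i, e (b i))).2 i); split=> [i||].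
- by have [_ Pi _ _] := Hf (b i, e (b i)); exact: Pi.
- apply/(bsum_blocks _ (erefl : e 0%N = 0%N) e_incr) => //.
  apply: bsum_le bsum_geometric => m; have [_ _ um _] := Hf (m, e m).
  by apply: le_trans um; rewrite !big_nat; apply: ler_sum => i /bE ->.
move=> /(bsum_blocks _ (erefl : e 0%N = 0%N) e_incr) => /(_ (fun i => v0 i _)).
move=> /(bsum_eventually_lt _ ltr01)[|k /(_ k (leqnn k))].
  by move=> i; apply: sumr_ge0.
have [_ _ _ vm] := Hf (k, e k); rewrite ltNge; apply/negP/negPn.
by apply: le_trans vm _; rewrite !big_nat; apply: ler_sum => i /bE ->.
Qed.

End rigidity.

(** * A reduction forces almost inclusion *)

Section irreducible.
Context (R : realType) (p : R).
Hypothesis p1 : 1 <= p.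

Let EU (U : set nat) := Erel (weight p U) (expo p U).

Let expo1 (U : set nat) n : 1 <= expo p U n <= p + 1.
Proof. by have /andP[pe ->] := expo_bound p U n; rewrite (le_trans p1 pe). Qed.

Let weight0 (U : set nat) n : 0 < weight p U n.
Proof. exact: weight_gt0. Qed.

Lemma Erel_eventually (w e : nat -> R) (x y : nat -> int) :
  (forall n, 0 < w n) -> (forall n, 1 <= e n <= p + 1) ->
  (exists n, forall i, (n <= i)%N -> x i = y i) -> Erel w e x y.
Proof.
move=> w0 e1 [n xy].
apply: (@bsum_eventually _ _ (fun=> 0) n) => // [i ni|i|].
- by rewrite xy// (cost_refl w e1).
- exact: (cost_ge0 _ w0).
by exists 0 => m; rewrite big1.
Qed.

Lemma infinite_setD (U V : set nat) : ~ almost_subset U V ->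
  forall m, exists k, [/\ (m <= k)%N, U k & ~ V k].
Proof.
move=> nUV m; apply: contrapT => nk; apply: nUV.
apply: (@sub_finite_set _ _ `I_m); last exact: finite_II.
move=> k [Uk nVk] /=; rewrite ltnNge; apply/negP => mk.
by apply: nk; exists k.
Qed.

Lemma almost_subset_of_reducible (U V : set nat) :
  borel_reducible (EU U) (EU V) -> almost_subset U V.
Proof.
move=> [th bth red]; apply: contrapT => /infinite_setD UV.
have [G dG th_cont] := generic_continuous (0 : int) bth.
pose W k := U k /\ ~ V k.
have [k0 [_ Uk0 Vk0]] := UV 0%N.
(* Free coordinate [i] will be attached to [kd i]; every k in [U] outside [V] is used infinitely
   often, and [k0] fills the remaining slots. *)
pose kd i := if `[< W (typ i) >] then typ i else k0.
have kdW i : W (kd i) by rewrite /kd; case: ifPn => [/asboolP//|_].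
have kd_cofinal k m : W k -> exists2 i, (m <= i)%N & kd i = k.
  move=> Wk; have [i mi ik] := typ_cofinal k m; exists i => //.
  by rewrite /kd ik; case: ifPn => // /asboolPn.
pose cU := cost (weight p U) (expo p U).
pose cV := cost (weight p V) (expo p V).
have cU0 n a b : 0 <= cU n a b by exact: (cost_ge0 _ (weight0 U)).
have cV0 n a b : 0 <= cV n a b by exact: (cost_ge0 _ (weight0 V)).
have cUxx n a : cU n a a = 0 by exact: (cost_refl _ (expo1 U)).
have cVxx n a : cV n a a = 0 by exact: (cost_refl _ (expo1 V)).
pose vals i := [seq Posz m | m <- iota 0 (gsize (kd i)).+1].
have valsP i m : (m <= gsize (kd i))%N -> Posz m \in vals i.
  by move=> mk; apply: map_f; rewrite mem_iota.
have [| |i m| |q [N [hat [q_incr [N0 N_incr] hatq hat_off hat_add]]]] :=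
  @additive_form R int int 0 th G cV dG th_cont cV0 _ cVxx vals
    (fun i n => typ n = (kd i).+1) (fun i => 2^-1 ^+ i) (fun=> 0).
- move=> x y xy; have : EU V (th x) (th y); last by [].
  by apply/red; exact: Erel_eventually xy.
- by move=> i; rewrite exprn_gt0.
- by have [n] := typ_cofinal (kd i).+1 m; exists n.
- by move=> i; exact: (valsP i 0%N).
pose upd (i : nat) (a : int) (k : nat) : int := if k == i then a else 0.
(* The output cost, within block [i], of changing free coordinate [i] from [a] to [b] while all
   others are 0. *)
pose D i (a b : int) := \sum_(N i <= j < N i.+1)
  cV j (th (hat (upd i a)) j) (th (hat (upd i b)) j).
have D0 i a b : 0 <= D i a b by rewrite sumr_ge0.
pose C : R := 2 `^ (p + 1).
have C0 : 0 <= C by exact: powR_ge0.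
have cV_tri n a b c : cV n a c <= C * (cV n a b + cV n b c).
  exact: (cost_quasi_triangle (weight0 V) (expo1 V)).
have cV_sym n a b : cV n a b = cV n b a by exact: cost_sym.
have cV_tri3 n a b c d : cV n a d <= C * (cV n a b + C * (cV n b c + cV n d c)).
  apply: le_trans (cV_tri _ _ b _) _; rewrite ler_wpM2l// lerD2l.
  by apply: le_trans (cV_tri _ _ c _) _; rewrite (cV_sym n c d).
(* The reduction becomes an equivalence of two series with one term per free coordinate: by the
   quasi-triangle inequality, [D] and the true block cost bound each other up to constant factors
   and a summable error. *)
have bsum_cD x y : (forall i, x i \in vals i) -> (forall i, y i \in vals i) ->
    bsum (fun i => cU (q i) (x i) (y i)) <-> bsum (fun i => D i (x i) (y i)).
  move=> xv yv.
  have -> : bsum (fun i => cU (q i) (x i) (y i)) <-> EU U (hat x) (hat y).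
    rewrite /EU /Erel (@bsum_sparse _ (fun n => cU n (hat x n) (hat y n)) q)//.
    - rewrite (_ : _ \o q = (fun i => cU (q i) (x i) (y i)))//.
      by apply/funext => i; rewrite /= !hatq.
    - by move=> i; have [] := q_incr i.
    - by move=> n nq; rewrite (hat_off x y n nq); exact: cUxx.
  rewrite red /EU /Erel (bsum_blocks _ N0 N_incr); last by move=> j; exact: cV0.
  pose err i : R := 2^-1 ^+ i.
  have be : bsum err by exact: bsum_geometric.
  have ax i := hat_add x xv i; have ay i := hat_add y yv i.
  have bb (f : nat -> R) : bsum f ->
      bsum (fun i => C * (err i + C * (f i + err i))).
    by move=> bf; apply: bsumZ => //; apply: bsumD => //; apply: bsumZ => //; exact: bsumD.
  split=> /bb; apply: bsum_le => i.
  - apply: (@le_trans _ _ (\sum_(N i <= j < N i.+1) C *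
      (cV j (th (hat (upd i (x i))) j) (th (hat x) j) + C *
        (cV j (th (hat x) j) (th (hat y) j) +
         cV j (th (hat (upd i (y i))) j) (th (hat y) j))))).
      by apply: ler_sum => j _; exact: cV_tri3.
    rewrite -mulr_sumr big_split/= -mulr_sumr big_split/=.
    rewrite ler_wpM2l// lerD// ?ler_wpM2l// ?lerD//.
      by under eq_bigr do rewrite cV_sym; exact: ax.
    by under eq_bigr do rewrite cV_sym; exact: ay.
  - apply: (@le_trans _ _ (\sum_(N i <= j < N i.+1) C *
      (cV j (th (hat x) j) (th (hat (upd i (x i))) j) + C *
        (cV j (th (hat (upd i (x i))) j) (th (hat (upd i (y i))) j) +
         cV j (th (hat y) j) (th (hat (upd i (y i))) j))))).
      by apply: ler_sum => j _; exact: cV_tri3.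
    rewrite -mulr_sumr big_split/= -mulr_sumr big_split/=.
    by rewrite ler_wpM2l// lerD// ?ler_wpM2l// ?lerD//.
pose P i (ab : int * int) := ab.1 \in vals i /\ ab.2 \in vals i.
pose fast (u v : nat -> int * int -> R) (K : R) := exists2 c, 0 < c &
  forall i0, exists i ab, [/\ (i0 <= i)%N, P i ab, K * u i ab <= v i ab,
    u i ab <= K^-1 & c <= v i ab].
pose fU i (ab : int * int) := cU (q i) ab.1 ab.2.
pose fV i (ab : int * int) := D i ab.1 ab.2.
have P0 i : P i (0, 0) by split; exact: (valsP i 0%N).
have fU0 i : fU i (0, 0) = 0 by exact: cUxx.
have fV0 i : fV i (0, 0) = 0 by apply: big1 => j _; exact: cVxx.
(* If [fast fU fV K] held for all [K], [greedy_separation] would give related points with unrelated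
   images, against [bsum_cD]. The next claim exchanges the two sides. *)
have [KA KA0 nA] : exists2 K, 0 < K & ~ fast fU fV K.
  apply: contrapT => nK.
  have [||||s [Ps sU sV]] := @greedy_separation R _ (0, 0) fU fV P.
  - by move=> i; split; [exact: P0|].
  - by move=> i ab; exact: cU0.
  - by move=> i ab; exact: D0.
  - by move=> K K0; apply: contrapT => nf; apply: nK; exists K.
  apply: sV; apply/(bsum_cD (fst \o s) (snd \o s)) => // i.
  + by have [] := Ps i.
  + by have [] := Ps i.
have [KB KB0 nB] : exists2 K, 0 < K & ~ fast fV fU K.
  apply: contrapT => nK.
  have [||||s [Ps sV sU]] := @greedy_separation R _ (0, 0) fV fU P.
  - by move=> i; split; [exact: P0|].
  - by move=> i ab; exact: D0.
  - by move=> i ab; exact: cU0.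
  - by move=> K K0; apply: contrapT => nf; apply: nK; exists K.
  apply: sU; apply/(bsum_cD (fst \o s) (snd \o s)) => // i.
  + by have [] := Ps i.
  + by have [] := Ps i.
(* One constant above [KA] and [KB]; k is then chosen with K^2 <= k+1. *)
pose K := KA + KB + 1.
have [k [kK Uk nVk]] := UV (Num.bound (K ^+ 2)).+1.
have K1 : 1 <= K by rewrite /K; lra.
have kpos : (0 < k)%N by apply: leq_trans kK.
have K2k : K ^+ 2 <= k.+1%:R.
  have /archi_boundP/ltW/le_trans : 0 <= K ^+ 2 by rewrite exprn_ge0//; lra.
  by apply; rewrite ler_nat; apply: leq_trans (leqW kK); exact: leqnSn.
have Kk : K <= k.+1%:R by apply: le_trans K2k; rewrite expr2 ler_peMl//; lra.
have Kk0 : 0 < k.+1%:R :> R by rewrite ltr0n.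
pose Phi := alpha p k * (gsize k)%:R `^ pexp p k.
have a0 := alpha_gt0 p1 k.
have g1 : 1 <= (gsize k)%:R `^ pexp p k :> R.
  apply: powR_ge1; first by rewrite ler1n gsize_gt0.
  by apply/ltW/(lt_trans _ (pexp_gt p k)); exact: lt_le_trans ltr01 p1.
have Phi0 : 0 < Phi by rewrite mulr_gt0// (lt_le_trans ltr01).
have Phi_le : Phi <= k.+1%:R^-1 by exact: alpha_gsize.
(* The constant [c] in [fast] may depend on k: its failure is used here with a multiple of the cost
   of a unit step, and next with the cost [Phi] of the pair 0, [gsize k]. *)
have [iA HA] : exists i0, forall i ab, (i0 <= i)%N -> P i ab ->
    KA * fU i ab <= fV i ab -> fU i ab <= KA^-1 -> ~ (KA * alpha p k <= fV i ab).
  apply: contrapT => ni; apply: nA; exists (KA * alpha p k); first exact: mulr_gt0.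
  move=> i0; apply: contrapT => nj; apply: ni; exists i0 => i ab i0i Pi H1 H2 H3.
  by apply: nj; exists i, ab.
have [iB HB] : exists i0, forall i ab, (i0 <= i)%N -> P i ab ->
    KB * fV i ab <= fU i ab -> fV i ab <= KB^-1 -> ~ (Phi <= fU i ab).
  apply: contrapT => ni; apply: nB; exists Phi => //.
  move=> i0; apply: contrapT => nj; apply: ni; exists i0 => i ab i0i Pi H1 H2 H3.
  by apply: nj; exists i, ab.
have [i iAB ik] := kd_cofinal k (maxn iA iB) (conj Uk nVk).
have cUE a b : cU (q i) a b = alpha p k * zdist R a b `^ pexp p k.
  rewrite /cU /cost /weight /expo; have [_ ->] := q_incr i; rewrite ik.
  by case: ifPn => // /asboolPn.
(* A unit step has input cost [alpha p k]; an image cost of [KA] times that would contradict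
   [HA]. *)
have step m : (m < gsize k)%N -> D i (Posz m) (Posz m.+1) < K * alpha p k.
  move=> mk; have fUm : fU i (Posz m, Posz m.+1) = alpha p k.
    by rewrite /fU cUE/= zdist_succ powR1 mulr1.
  have : ~ (KA * alpha p k <= D i (Posz m) (Posz m.+1)).
    move=> H; apply: (HA i (Posz m, Posz m.+1)) => //.
    - exact: leq_trans (leq_maxl _ _) iAB.
    - by split; apply: valsP; rewrite ik// ltnW.
    - by rewrite fUm.
    rewrite fUm; apply: (@le_trans _ _ Phi); first by rewrite ler_peMr// ltW.
    by apply: le_trans Phi_le _; rewrite lef_pV2 ?posrE//; apply: le_trans Kk; rewrite /K; lra.
  move=> /negP; rewrite -ltNge => /lt_le_trans; apply.
  by rewrite ler_wpM2r ?(ltW a0)// /K; lra.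
(* [block_rigid] bounds the image cost by N^(p_(k+1)) K alpha_k with N = [gsize k], which
   [gsize_powR] turns into Phi K / (k+1). *)
have Dg : D i (Posz 0) (Posz (gsize k)) <= Phi * K / k.+1%:R.
  have := @block_rigid R p p1 V k (fun m => th (hat (upd i (Posz m)))) (N i) (N i.+1)
    (K * alpha p k) nVk _ kpos step.
  rewrite ler_wpM2r ?(ltW a0)// => /(_ isT)/le_trans; apply.
  rewrite /Phi gsize_powR mulrA (mulrAC _ _ K) mulfK ?gt_eqF//.
  by rewrite mulrCA mulrC (mulrC (alpha p k)).
have fUg : fU i (Posz 0, Posz (gsize k)) = Phi.
  by rewrite /fU cUE/= (_ : zdist R 0 (gsize k) = (gsize k)%:R)//
    /zdist mulr0z sub0r normrN ger0_norm.
have KBD : KB * D i (Posz 0) (Posz (gsize k)) <= Phi.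
  apply: (@le_trans _ _ (K * (Phi * K / k.+1%:R))).
    by apply: ler_pM => //; [exact: ltW|rewrite /K; lra].
  rewrite mulrCA -mulrA ler_piMr ?(ltW Phi0)//.
  by rewrite mulrA -expr2 ler_pdivrMr// mul1r.
(* The pair has input cost [Phi] but image cost at most [Phi / KB], against [HB]. *)
apply: (HB i (Posz 0, Posz (gsize k))).
- exact: leq_trans (leq_maxr _ _) iAB.
- by split; apply: valsP; rewrite ik.
- by rewrite fUg.
- rewrite -[leRHS]mul1r ler_pdivlMr// mulrC; apply: le_trans KBD _.
  by apply: le_trans Phi_le _; rewrite invf_le1// ler1n.
- by rewrite fUg.
Qed.

End irreducible.
(** * Reductions *)

Section reductions.
Context (R : realType) (p : R).
Hypothesis p1 : 1 <= p.

Lemma nneseries_ltyP (a : nat -> R) : (forall n, 0 <= a n) ->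
  (\sum_(0 <= n <oo) (a n)%:E < +oo)%E <-> bsum a.
Proof.
move=> a0; split=> [aoo|[M aM]].
  exists (fine (\sum_(0 <= n <oo) (a n)%:E)%E) => n.
  rewrite -lee_fin fineK; last first.
    rewrite ge0_fin_numE//; apply: nneseries_ge0 => i _ _.
    by rewrite lee_fin.
  rewrite -sumEFin; apply: nneseries_lim_ge => i _ _.
  by rewrite lee_fin.
apply: (@le_lt_trans _ _ M%:E); last exact: ltry.
apply: lime_le; first by apply: is_cvg_nneseries => n _ _; rewrite lee_fin.
by near=> n; rewrite sumEFin lee_fin.
Unshelve. all: end_near. Qed.

Lemma lr_equivP (r : R) (x y : {ptws nat -> R}) :
  lr_equiv r x y <-> bsum (fun n => `|x n - y n| `^ r).
Proof. by apply: nneseries_ltyP => n; exact: powR_ge0. Qed.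

Lemma bsum_small (a b : nat -> R) (c : R) : 0 < c ->
  (forall n, 0 <= a n) -> (forall n, 0 <= b n) ->
  (forall n, a n < c -> b n <= a n) -> bsum a -> bsum b.
Proof.
move=> c0 a0 b0 ab ba; have [k Hk] := bsum_eventually_lt a0 c0 ba.
by apply: (@bsum_eventually _ _ a k) => // i ki; apply: ab; exact: Hk.
Qed.

(* Where the two data differ, both terms are bounded below unless they vanish,
   so their sums converge only if almost all of them vanish. *)
Lemma Erel_reducible (w e w' e' : nat -> R) (mul : nat -> nat) (c : R) :
  (forall n, 0 < w n) -> (forall n, 1 <= e n <= p + 1) ->
  (forall n, 0 < w' n) -> (forall n, 1 <= e' n <= p + 1) -> 0 < c ->
  (forall n, (0 < mul n)%N) ->
  (forall n, [/\ w n = w' n, e n = e' n & mul n = 1%N] \/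
             (c <= w n /\ c <= w' n * (mul n)%:R `^ e' n)) ->
  forall x y : nat -> int,
    Erel w e x y <-> Erel w' e' (fun n => (mul n)%:Z * x n) (fun n => (mul n)%:Z * y n).
Proof.
move=> w0 e1 w'0 e'1 c0 mul0 H x y.
have zdistM n (a b : int) : zdist R (n%:Z * a) (n%:Z * b) = n%:R * zdist R a b.
  by rewrite /zdist !intrM -mulrBr normrM ger0_norm.
have E0 n a b : 0 <= cost w e n a b by exact: cost_ge0.
have E'0 n a b : 0 <= cost w' e' n a b by exact: cost_ge0.
have alt n : cost w e n (x n) (y n) = cost w' e' n ((mul n)%:Z * x n) ((mul n)%:Z * y n) \/
    [\/ x n = y n | c <= cost w e n (x n) (y n) /\
                c <= cost w' e' n ((mul n)%:Z * x n) ((mul n)%:Z * y n)].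
  have [[we ee m1]|[cw cw']] := H n.
    by left; rewrite /cost zdistM we ee m1 mul1r.
  right; have [xy|xy] := eqVneq (x n) (y n); first by left.
  right; split.
    by apply: le_trans cw _; exact: (cost_ge_weight w0 e1).
  apply: le_trans cw' _; rewrite /cost zdistM powRM ?zdist_ge0// mulrA.
  rewrite ler_peMr//; first by rewrite mulr_ge0 ?powR_ge0// ltW.
  rewrite powR_ge1 ?zdist_ge1//; have /andP[] := e'1 n; lra.
split; apply: (bsum_small c0) => // n.
- by have [->//|[->|[+ _]]] := alt n; [rewrite !(cost_refl _ e'1)|rewrite leNgt => /negP].
- by have [->//|[->|[_ +]]] := alt n; [rewrite !(cost_refl _ e1)|rewrite leNgt => /negP].
Qed.

Lemma borel_map_coordinatewise (f : nat -> int -> int) :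
  borel_map (fun x : seqspace int => (fun n => f n (x n)) : seqspace int).
Proof.
apply: (borel_map_seqspace (0 : int)) => n v; apply: borel_open.
by apply/open_seqspaceP => x xv; exists n.+1 => y xy; rewrite /= -xy.
Qed.

Lemma bounded_nat (P : set nat) : finite_set P -> exists k, forall n, P n -> (n < k)%N.
Proof.
move=> /finite_seqP[s ->]; exists (\max_(i <- s) i).+1 => n ns.
by rewrite ltnS; exact: leq_bigmax_seq.
Qed.

Lemma reducible_of_almost_subset (U V : set nat) : almost_subset U V ->
  borel_reducible (Erel (weight p U) (expo p U)) (Erel (weight p V) (expo p V)).
Proof.
move=> /bounded_nat[K HK].
have expo1 W n : 1 <= expo p W n <= p + 1.
  by have /andP[pe ->] := expo_bound p W n; rewrite (le_trans p1 pe).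
(* For k in [V] outside [U] the weight drops from 1 to alpha_k; multiplying by an integer above
   1/alpha_k keeps the cost of distinct entries at least 1, uniformly in the possibly infinitely
   many such k. *)
pose mul n := if typ n is k.+1 then
  if `[< ~ U k /\ V k >] then (Num.bound (alpha p k)^-1).+1 else 1%N else 1%N.
exists (fun x : seqspace int => (fun n => (mul n)%:Z * x n) : seqspace int).
  exact: (borel_map_coordinatewise (fun n a => (mul n)%:Z * a)).
have a1 k : alpha p k <= 1.
  apply: le_trans (alpha_le p1 (leq0n k)) _.
  rewrite /alpha big_ord1 invf_le1 ?alpha_factor_ge1//.
  exact: lt_le_trans ltr01 (alpha_factor_ge1 p1 _).
(* Every k in [U] outside [V] is below [K], so [alpha p K] bounds the weights concerned from
   below. *)
apply: (@Erel_reducible _ _ _ _ mul (alpha p K)) => //.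
- by move=> n; exact: weight_gt0.
- by move=> n; exact: weight_gt0.
- exact: alpha_gt0.
- by move=> n; rewrite /mul; case: typ => // k; case: ifP.
move=> n; rewrite /mul /weight /expo; case: (typ n) => [|k]; first by left.
have [Uk|nUk] := pselect (U k); have [Vk|nVk] := pselect (V k).
- have nUV : ~ (~ U k /\ V k) by case.
  by left; rewrite (asboolT Uk) (asboolT Vk) (asboolF nUV).
- have nUV : ~ (~ U k /\ V k) by case.
  rewrite (asboolT Uk) (asboolF nVk) (asboolF nUV); right.
  by rewrite powR1 mulr1 a1 alpha_le// ltnW// HK.
- right; rewrite (asboolF nUk) (asboolT Vk) (asboolT (conj nUk Vk)) a1; split=> //.
  apply: le_trans (a1 K) _.
  have a0 := alpha_gt0 p1 k.
  set m := (Num.bound _).+1.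
  have m1 : (alpha p k)^-1 <= m%:R.
    have /archi_boundP/ltW/le_trans : 0 <= (alpha p k)^-1 by rewrite invr_ge0 ltW.
    by apply; rewrite ler_nat.
  apply: (@le_trans _ _ (alpha p k * m%:R)).
    by rewrite -ler_pdivrMl// mulr1.
  rewrite ler_wpM2l ?(ltW a0)// -[leLHS]powRr1// ler_powR//.
    by rewrite ler1n.
  by apply: le_trans p1 (ltW (pexp_gt _ _)).
- have nUV : ~ (~ U k /\ V k) by case.
  by left; rewrite (asboolF nUk) (asboolF nVk) (asboolF nUV).
Qed.

(** Entry m is coded at coordinate n = 2m, of type 0 because n+1 is odd, by the floor of 2^n x_m;
    odd coordinates are 0. The cost at n is the p-th power of the distance of the dyadic
    approximations, whose errors of at most 2^(-m) have summable p-th powers. *)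
Lemma lr_equiv_reducible (U : set nat) :
  borel_reducible (@lr_equiv R p) (Erel (weight p U) (expo p U)).
Proof.
pose fl n (t : R) : int := Num.floor (2 ^+ n * t).
exists (fun x : {ptws nat -> R} =>
    (fun n => if odd n then 0 else fl n (x n./2)) : seqspace int).
  apply: (borel_map_seqspace (0 : int)) => n v; case: (odd n).
    have [->|v0] := eqVneq v 0.
      by rewrite (_ : [set _ | _] = setT); [exact: borelT|apply/seteqP; split].
    rewrite (_ : [set _ | _] = set0); first exact: borel0.
    by apply/seteqP; split=> // x /= /esym/eqP; rewrite (negPf v0).
  have half_open (r : R) : borel [set x : {ptws nat -> R} | r <= 2 ^+ n * x n./2].
    rewrite (_ : [set _ | _] = ~` [set x : {ptws nat -> R} | 2 ^+ n * x n./2 < r]); last first.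
      by apply/seteqP; split=> x /=; rewrite leNgt => /negP.
    apply: borelC; apply: borel_open.
    rewrite (_ : [set _ | _] = (@proj nat (fun=> R) n./2) @^-1` [set t | t < r / 2 ^+ n]).
      apply: open_comp; last exact: open_lt.
      by move=> x _; exact: proj_continuous.
    by apply/seteqP; split=> x /=; rewrite ltr_pdivlMr ?exprn_gt0// mulrC.
  rewrite (_ : [set _ | _] = [set x : {ptws nat -> R} | v%:~R <= 2 ^+ n * x n./2] `&`
    ~` [set x : {ptws nat -> R} | (v + 1)%:~R <= 2 ^+ n * x n./2]).
    by apply: borelI => //; exact: borelC.
  apply/seteqP; split=> x /=; rewrite /fl.
    by move=> /eqP; rewrite floor_eq => /andP[-> xv]; split=> //; rewrite leNgt xv.
  by move=> [vx /negP]; rewrite -ltNge => xv; apply/eqP; rewrite floor_eq vx.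
move=> x y; rewrite lr_equivP /Erel.
have expo1 n : 1 <= expo p U n <= p + 1.
  by have /andP[pe ->] := expo_bound p U n; rewrite (le_trans p1 pe).
rewrite (@bsum_sparse _ (fun n => cost (weight p U) (expo p U) n
    (if odd n then 0 else fl n (x n./2)) (if odd n then 0 else fl n (y n./2))) double);
  last 3 first.
- by move=> n; exact: (cost_ge0 _ (weight_gt0 p1 U)).
- by move=> i; rewrite doubleS.
- move=> n nd; case: ifPn => [_|/negbTE on]; first exact: (cost_refl _ expo1).
  by case: (nd n./2); rewrite -[LHS]odd_double_half on.
have p0 : 0 <= p := le_trans ler01 p1.
pose dm m := 2^-1 ^+ m.*2 * zdist R (fl m.*2 (x m)) (fl m.*2 (y m)).
have dm0 m : 0 <= dm m by rewrite mulr_ge0 ?zdist_ge0// exprn_ge0// invr_ge0.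
rewrite (_ : _ \o _ = fun m => dm m `^ p); last first.
  apply/funext => m; rewrite /= odd_double doubleK /cost /weight /expo.
  have -> : typ m.*2 = 0%N by rewrite /typ lognE dvdn2/= odd_double.
  by rewrite -powRM ?zdist_ge0// exprn_ge0// invr_ge0.
pose err m : R := 2^-1 ^+ m.
have err0 m : 0 <= err m by rewrite exprn_ge0// invr_ge0.
have flE n t : `|2^-1 ^+ n * (fl n t)%:~R - t| <= 2^-1 ^+ n.
  have /andP[f1 f2] := floor_itv (2 ^+ n * t); rewrite -/(fl n t) intrD in f1 f2.
  have e0 : 0 < 2^-1 ^+ n :> R by rewrite exprn_gt0// invr_gt0.
  have {2}-> : t = 2^-1 ^+ n * (2 ^+ n * t).
    by rewrite mulrA -exprMn mulVf ?expr1n ?mul1r// pnatr_eq0.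
  rewrite -mulrBr normrM (gtr0_norm e0) ler_piMr ?(ltW e0)//.
  by rewrite ler_norml; apply/andP; split; lra.
have close m : `|dm m - `|x m - y m| | <= 2 * err m.
  rewrite /dm /zdist -[X in X * _]ger0_norm ?exprn_ge0 ?invr_ge0// -normrM.
  apply: le_trans (ler_dist_dist _ _) _; rewrite mulrBr opprB.
  set a := _ * _%:~R; set b := _ * _%:~R.
  rewrite (_ : a - b + (y m - x m) = (a - x m) - (b - y m)); last by ring.
  apply: le_trans (ler_normB _ _) _; rewrite mulr_natl mulr2n lerD//.
    apply: le_trans (flE _ _) _; rewrite /err -addnn exprD ler_piMl ?err0//.
    by rewrite exprn_ile1 ?invr_ge0// invf_le1// ler1n.
  apply: le_trans (flE _ _) _; rewrite /err -addnn exprD ler_piMl ?err0//.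
  by rewrite exprn_ile1 ?invr_ge0// invf_le1// ler1n.
have berr : bsum (fun m => (2 * err m) `^ p).
  apply: (@bsum_le _ _ (fun m => 2 `^ p * err m)) => [m|]; last first.
    by apply: bsumZ; [exact: powR_ge0|exact: bsum_geometric].
  rewrite powRM// ler_wpM2l ?powR_ge0//.
  have e1 : 0 < err m <= 1.
    by rewrite exprn_gt0 ?invr_gt0// exprn_ile1 ?invr_ge0// invf_le1// ler1n.
  by rewrite -[leRHS]powRr1//; exact: ger_powR.
have transfer (a b : nat -> R) : (forall m, 0 <= a m) -> (forall m, 0 <= b m) ->
    (forall m, a m <= b m + 2 * err m) ->
    bsum (fun m => b m `^ p) -> bsum (fun m => a m `^ p).
  move=> a0 b0 ab bb.
  apply: (@bsum_le _ _ (fun m => 2 `^ p * (b m `^ p + (2 * err m) `^ p))) => [m|].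
    have e0 : 0 <= 2 * err m by rewrite mulr_ge0.
    apply: le_trans (powR_quasi_triangle (p := p) _ (b0 m) e0); last by rewrite p0 lexx.
    by rewrite ge0_ler_powR ?nnegrE ?addr_ge0.
  by apply: bsumZ; rewrite ?powR_ge0//; exact: bsumD.
by split; apply: transfer => // m; have := close m; rewrite ler_norml => /andP[]; lra.
Qed.

End reductions.
(** * Embedding snowflakes of the integers *)

Section snowflake.
Context {R : realType}.
Implicit Types (x y : R).

Lemma sin_le_id x : 0 <= x -> sin x <= x.
Proof.
rewrite le_eqVlt => /predU1P[<-|x0]; first by rewrite sin0.
have [c _] := @MVT R sin cos 0 x x0 (fun c _ => is_derive_sin c)
  (continuous_subspaceT (@continuous_sin R)).
by rewrite sin0 !subr0 => ->; rewrite ler_piMl ?cos_le1// ltW.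
Qed.

Lemma norm_sin_le x : `|sin x| <= `|x|.
Proof.
wlog x0 : x / 0 <= x.
  by move=> H; have [/H//|/ltW x0] := leP 0 x; rewrite -normrN -sinN -(normrN x) H// oppr_ge0.
have [x1|x1] := leP 1 x.
  by apply: le_trans (sin_max x) _; rewrite ger0_norm.
rewrite !ger0_norm ?sin_le_id//.
move: x0; rewrite le_eqVlt => /predU1P[<-|x0]; first by rewrite sin0.
by apply/ltW/sin2_gt0; lra.
Qed.

Lemma sin_sub x y : sin x - sin y = 2 * cos ((x + y) / 2) * sin ((x - y) / 2).
Proof.
have -> : sin x = sin ((x + y) / 2 + (x - y) / 2) by congr sin; field.
have -> : sin y = sin ((x + y) / 2 - (x - y) / 2) by congr sin; field.
by rewrite sinD sinB; ring.
Qed.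

Lemma sin_lipschitz x y : `|sin x - sin y| <= `|x - y|.
Proof.
rewrite sin_sub !normrM (ger0_norm (x := 2))//.
apply: (@le_trans _ _ (2 * 1 * `|(x - y) / 2|)).
  by rewrite !ler_pM ?cos_max ?norm_sin_le// mulr_ge0.
by rewrite mulr1 normrM (ger0_norm (x := 2^-1))// mulrCA mulfV ?mulr1// pnatr_eq0.
Qed.

Lemma norm_sin_ge x : 4^-1 <= `|x| <= 1 -> sin 4^-1 <= `|sin x|.
Proof.
wlog x0 : x / 0 <= x.
  move=> H; have [/H//|/ltW x0] := leP 0 x.
  by have := H (- x); rewrite sinN !normrN oppr_ge0; exact.
rewrite ger0_norm// => /andP[x4 x1]; apply: le_trans (ler_norm _).
have pi2 := pi_ge2 R.
move: x4; rewrite le_eqVlt => /predU1P[->//|x4].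
by rewrite ltW// ltr_sin// in_itv/=; apply/andP; split; lra.
Qed.

(* [cos] cannot be small at both [x] and [x / 2], so one of the scales [A, B]
   and [A / 2, B / 2] separates. *)
Lemma sin_separates (A B : R) : 2^-1 <= `|(A - B) / 2| <= 1 ->
  sin 4^-1 <= `|sin A - sin B| \/ sin 4^-1 <= `|sin (A / 2) - sin (B / 2)|.
Proof.
move=> /andP[h1 h2]; have s0 : 0 <= sin (4^-1 : R) by apply/ltW/sin2_gt0; lra.
have [c1|c1] := leP 2^-1 `|cos ((A + B) / 2)|.
  left; rewrite sin_sub !normrM (ger0_norm (x := 2))//.
  rewrite -[leLHS]mul1r ler_pM//; first by lra.
  by apply: norm_sin_ge; rewrite h2 andbT; lra.
right; rewrite sin_sub !normrM (ger0_norm (x := 2))//.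
have -> : (A / 2 + B / 2) / 2 = (A + B) / 2 / 2 by field.
have -> : (A / 2 - B / 2) / 2 = (A - B) / 2 / 2 by field.
rewrite -[leLHS]mul1r ler_pM//; last first.
  by apply: norm_sin_ge; rewrite normrM (ger0_norm (x := 2^-1))//; apply/andP; split; lra.
set v := (A + B) / 2 in c1 *.
have cv : cos v = 2 * `|cos (v / 2)| ^+ 2 - 1.
  have {1}-> : v = v / 2 + v / 2 by field.
  rewrite cosD -!expr2 sin2cos2 real_normK ?num_real//; ring.
rewrite leNgt; apply/negP => c2; move: c1; rewrite cv ltNge => /negP; apply.
have c0 : 0 <= `|cos (v / 2)| by [].
rewrite ler0_norm; nra.
Qed.

(** The q-th power of the difference at [a] and [b] of the function 2^(m e / q) sin(. / 2^m), one
    coordinate of the snowflake embedding. *)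
Definition scale (e q : R) (a b : int) (m : nat) : R :=
  (2 ^+ m) `^ e * `|sin (a%:~R / 2 ^+ m) - sin (b%:~R / 2 ^+ m)| `^ q.

Lemma scale_ge0 e q a b m : 0 <= scale e q a b m.
Proof. by rewrite mulr_ge0 ?powR_ge0. Qed.

Lemma zdist_pow2 (a b : int) : a != b ->
  exists L, 2 ^+ L <= zdist R a b /\ zdist R a b < 2 ^+ L.+1.
Proof.
move=> ab; exists (trunc_log 2 `|a - b|).
have -> : zdist R a b = `|a - b|%N%:R.
  by rewrite /zdist -intrB -intr_norm -natr_absz.
rewrite -!natrX ler_nat ltr_nat trunc_logP ?trunc_log_ltn//.
by rewrite absz_gt0 subr_eq0.
Qed.

(** Let 2^L <= |a - b| < 2^(L+1). Up to scale L the sines differ by at most 2 and the coefficients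
    grow geometrically; beyond it the Lipschitz bound leaves a geometric series of ratio at most
    2^(s-q) < 1. So the constant depends on s and q only. *)
Lemma scale_upper (s q : R) : 1 <= s < q -> exists2 C : R, 0 <= C &
  forall e a b M, 1 <= e <= s ->
    \sum_(0 <= m < M) scale e q a b m <= C * zdist R a b `^ e.
Proof.
move=> /andP[s1 sq]; pose rho : R := 2 `^ (s - q).
have rho0 : 0 < rho by rewrite powR_gt0.
have rho1 : rho < 1.
  rewrite /rho /powR pnatr_eq0/= expR_lt1 nmulr_rlt0 ?subr_lt0//.
  by rewrite ln_gt0// ltr1n.
pose C := 2 `^ q * 2 + (1 - rho)^-1.
have q0 : 0 <= 2 `^ q by exact: powR_ge0.
have C0 : 0 <= C by rewrite addr_ge0 ?mulr_ge0// invr_ge0; lra.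
exists C => // e a b M /andP[e1 es].
have [->|ab] := eqVneq a b.
  rewrite big1 ?mulr_ge0 ?powR_ge0// => m _.
  by rewrite /scale subrr normr0 powR0 ?mulr0//; lra.
have [L [tL Lt]] := zdist_pow2 ab; set t := zdist R a b in tL Lt *.
have t0 : 0 < t by apply: lt_le_trans tL; rewrite exprn_gt0.
have te0 : 0 < t `^ e by rewrite powR_gt0.
have D2 m : `|sin (a%:~R / 2 ^+ m) - sin (b%:~R / 2 ^+ m) : R| <= 2.
  apply: le_trans (ler_normB _ _) _.
  by rewrite (_ : 2 = 1 + 1)// lerD// sin_max.
have Dt m : `|sin (a%:~R / 2 ^+ m) - sin (b%:~R / 2 ^+ m) : R| <= t / 2 ^+ m.
  apply: le_trans (sin_lipschitz _ _) _.
  by rewrite -mulrBl normrM (ger0_norm (x := (2 ^+ m)^-1))// invr_ge0 exprn_ge0.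
have p2 m : 0 < 2 ^+ m :> R by rewrite exprn_gt0.
pose u m := 2 ^+ m / t.
have u0 m : 0 < u m by rewrite divr_gt0.
have scaleE m : scale e q a b m = t `^ e * (u m `^ e *
    `|sin (a%:~R / 2 ^+ m) - sin (b%:~R / 2 ^+ m)| `^ q).
  rewrite /scale mulrA -powRM ?ltW//; congr (_ `^ _ * _).
  by rewrite /u mulrCA mulfV ?mulr1// gt_eqF.
apply: le_trans (sum_nat_mono (fun m => scale_ge0 e q a b m) (leq_addl L.+1 M)) _.
rewrite (big_cat_nat (leq0n L.+1) (leq_addr _ _))/= mulrDl lerD//.
- apply: (@le_trans _ _ (\sum_(0 <= m < L.+1) t `^ e * (2 ^+ m / t * 2 `^ q))).
    rewrite !big_nat; apply: ler_sum => m /andP[_ mL]; rewrite scaleE.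
    rewrite ler_wpM2l ?(ltW te0)// ler_pM ?powR_ge0//; last first.
      by rewrite ge0_ler_powR ?nnegrE//; lra.
    (* Here u <= 1 <= e, so u^e <= u, which leaves a sum of powers of 2. *)
    rewrite -/(u m) -[leRHS]powRr1 ?(ltW (u0 m))//.
    apply: ger_powR => //; rewrite u0/= ler_pdivrMr// mul1r.
    by apply: le_trans tL; rewrite ler_weXn2l// ?ler1n.
  rewrite -mulr_sumr -mulr_suml -mulr_suml mulrC ler_wpM2r ?(ltW te0)// mulrC.
  rewrite ler_wpM2l// ler_pdivrMr//.
  have -> : \sum_(0 <= m < L.+1) 2 ^+ m = 2 ^+ L.+1 - 1 :> R.
    elim: (L.+1) => [|k IHk]; first by rewrite big_geq// expr0 subrr.
    by rewrite big_nat_recr//= IHk exprS; ring.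
  rewrite exprS; lra.
rewrite -{1}[L.+1]add0n big_addn addKn.
apply: (@le_trans _ _ (\sum_(0 <= i < M) t `^ e * rho ^+ i)).
  apply: ler_sum => i _; rewrite scaleE ler_wpM2l ?(ltW te0)//.
  set m := (i + L.+1)%N.
  apply: (@le_trans _ _ (u m `^ e * (u m)^-1 `^ q)).
    rewrite ler_wpM2l ?powR_ge0// ge0_ler_powR ?nnegrE ?invr_ge0 ?(ltW (u0 m))//.
      by lra.
    by rewrite /u invf_div.
  rewrite -powR_inv1 ?(ltW (u0 m))// -powRrM mulN1r -powRD; last first.
    by rewrite (gt_eqF (u0 m)) implybT.
  have u1 : 2 ^+ i <= u m.
    by rewrite /u ler_pdivlMr// /m exprD ler_wpM2l ?exprn_ge0// ltW.
  have i1 : 1 <= 2 ^+ i :> R by rewrite exprn_ege1// ler1n.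
  apply: (@le_trans _ _ (u m `^ (s - q))).
    by rewrite ler_powR ?(le_trans i1)// lerB.
  rewrite /rho -powR_mulrn ?powR_ge0// -powRrM mulrC powRrM powR_mulrn//.
  rewrite -(opprB q s) !powRN lef_pV2 ?posrE ?powR_gt0//.
  by rewrite ge0_ler_powR ?nnegrE ?(ltW (u0 m))//; lra.
rewrite -mulr_sumr mulrC ler_wpM2r ?(ltW te0)//.
have -> : \sum_(0 <= i < M) rho ^+ i = (1 - rho ^+ M) / (1 - rho).
  elim: M => [|M IHM]; first by rewrite big_geq// expr0 subrr mul0r.
  by rewrite big_nat_recr//= IHM exprS; field; lra.
rewrite ler_piMl ?invr_ge0//; first by lra.
by rewrite gerBl exprn_ge0// ltW.
Qed.

(** With L as in the upper bound, half the difference of the arguments at scale L has absolute value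
    between 1/2 and 1, so by [sin_separates] scale L or L+1 alone is large enough. *)
Lemma scale_lower (s q : R) : 1 <= s < q -> exists2 c : R, 0 < c &
  forall e a b, 1 <= e <= s -> exists M,
    c * zdist R a b `^ e <= \sum_(0 <= m < M) scale e q a b m.
Proof.
move=> /andP[s1 sq]; have s0 : 0 < sin (4^-1 : R) by apply/sin2_gt0; lra.
(* The division by 2 makes up for |a - b| being only below 2^(L+1), as (1/2)^q <= (1/2)^e. *)
exists ((sin 4^-1 / 2) `^ q); first by rewrite powR_gt0// divr_gt0.
move=> e a b /andP[e1 es]; have [->|ab] := eqVneq a b.
  by exists 0%N; rewrite big_geq// zdist_refl powR0 ?mulr0//; lra.
have [L [tL Lt]] := zdist_pow2 ab; set t := zdist R a b in tL Lt *.
have t0 : 0 < t by apply: lt_le_trans tL; rewrite exprn_gt0.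
exists L.+2.
have p2 : 0 < 2 ^+ L :> R by rewrite exprn_gt0.
have key m : (L <= m)%N -> sin 4^-1 <= `|sin (a%:~R / 2 ^+ m) - sin (b%:~R / 2 ^+ m) : R| ->
    (sin 4^-1 / 2) `^ q * t `^ e <= scale e q a b m.
  move=> Lm sm; rewrite powRM ?(ltW s0) ?invr_ge0// mulrAC -mulrA [leRHS]mulrC.
  rewrite ler_pM ?powR_ge0 ?mulr_ge0 ?powR_ge0//.
    by rewrite ge0_ler_powR ?nnegrE ?(ltW s0)//; lra.
  apply: (@le_trans _ _ ((t / 2) `^ e)); last first.
    rewrite ge0_ler_powR ?nnegrE ?divr_ge0 ?exprn_ge0 ?(ltW t0)//; first by lra.
    rewrite ler_pdivrMr// mulrC -exprS; apply: le_trans (ltW Lt) _.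
    by rewrite ler_weXn2l ?ler1n.
  rewrite (powRM _ (ltW t0)) ?invr_ge0// ler_wpM2l ?powR_ge0//.
  by apply: ger_powR; [rewrite invr_gt0 invf_le1//=; lra|lra].
pose d : R := (a%:~R / 2 ^+ L - b%:~R / 2 ^+ L) / 2.
have dE : `|d| = t / 2 ^+ L / 2.
  rewrite /d -mulrBl 2!normrM (ger0_norm (x := (2 ^+ L)^-1)) ?invr_ge0 ?ltW//.
  by rewrite (ger0_norm (x := 2^-1)).
have h : 2^-1 <= `|d| <= 1.
  rewrite dE; apply/andP; split.
    by rewrite ler_pdivlMr// mulVf ?pnatr_eq0// ler_pdivlMr// mul1r.
  by rewrite ler_pdivrMr// mul1r ler_pdivrMr// -exprS ltW.
have half (c : int) : c%:~R / 2 ^+ L / 2 = c%:~R / 2 ^+ L.+1 :> R.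
  by rewrite exprS; field; rewrite gt_eqF.
rewrite big_nat_recr//= big_nat_recr//= -addrA; have [sL|sL] := sin_separates h.
  rewrite ler_wpDl ?sumr_ge0//; first by move=> m _; exact: scale_ge0.
  by rewrite ler_wpDr ?scale_ge0// key.
rewrite !half in sL; rewrite ler_wpDl ?sumr_ge0//; first by move=> m _; exact: scale_ge0.
by rewrite ler_wpDl ?scale_ge0// key.
Qed.

End snowflake.

(** * Series over pairs of indices *)

Section double_sums.
Context {R : realType}.

Lemma ler_sum_subset (I : choiceType) (s t : seq I) (f : I -> R) : uniq s -> uniq t ->
  {subset s <= t} -> (forall i, 0 <= f i) -> \sum_(i <- s) f i <= \sum_(i <- t) f i.
Proof.
move=> us ut st f0; rewrite [leRHS](bigID (mem s))/=.
have -> : \sum_(i <- t | i \in s) f i = \sum_(i <- s) f i.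
  rewrite -big_filter; apply: perm_big; apply: uniq_perm => //.
    exact: filter_uniq.
  by move=> i; rewrite mem_filter; have [/st ->|] := boolP (i \in s).
by rewrite lerDl sumr_ge0.
Qed.

Lemma bsum_pairs (b : nat * nat -> R) : (forall i, 0 <= b i) ->
  bsum (fun j => oapp b 0 (pickle_inv j)) <->
  exists M, forall N, \sum_(0 <= n < N) \sum_(0 <= m < N) b (n, m) <= M.
Proof.
move=> b0.
pose sq N := [seq (n, m) | n <- iota 0 N, m <- iota 0 N].
have sum_sq N : \sum_(0 <= n < N) \sum_(0 <= m < N) b (n, m) = \sum_(i <- sq N) b i.
  by rewrite big_allpairs /index_iota subn0.
have sq_uniq N : uniq (sq N).
  by apply: allpairs_uniq; rewrite ?iota_uniq// => -[? ?] [? ?].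
have sqP N n m : ((n, m) \in sq N) = (n < N)%N && (m < N)%N.
  apply/allpairsP/andP => [[[n' m'] [/=]]|[nN mN]].
    by rewrite !mem_iota => n'N m'N [-> ->].
  by exists (n, m); rewrite !mem_iota.
pose pm N : seq (nat * nat) := pmap pickle_inv (iota 0 N).
have sum_pm N : \sum_(0 <= j < N) oapp b 0 (pickle_inv j) = \sum_(i <- pm N) b i.
  rewrite /pm /index_iota subn0; elim: (iota 0 N) => [|j s IHs]; first by rewrite !big_nil.
  rewrite big_cons IHs /=; case: (pickle_inv j) => [i|] /=; first by rewrite big_cons.
  by rewrite add0r.
have pm_uniq N : uniq (pm N).
  by apply: (pmap_uniq (@pickle_invK _)); exact: iota_uniq.
have pmP N i : (i \in pm N) = (pickle i < N)%N.
  rewrite mem_pmap; apply/mapP/idP => [[j + ij]|iN].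
    have := @pickle_invK (nat * nat)%type j.
    by rewrite -ij /= => ->; rewrite mem_iota.
  by exists (pickle i); rewrite ?mem_iota// pickleK_inv.
split=> -[M HM]; exists M => N.
  rewrite sum_sq; apply: le_trans (HM (\max_(i <- sq N) pickle i).+1).
  rewrite sum_pm; apply: ler_sum_subset => // i iN.
  by rewrite pmP ltnS; exact: leq_bigmax_seq.
rewrite sum_pm; apply: le_trans (HM (\max_(i <- pm N) (i.1 + i.2)%N).+1).
rewrite sum_sq; apply: ler_sum_subset => // -[n m] iN; rewrite sqP !ltnS.
have H : (n + m <= \max_(i <- pm N) (i.1 + i.2))%N.
  exact: (@leq_bigmax_seq _ (pm N) xpredT (fun i => i.1 + i.2)%N (n, m)).
by rewrite (leq_trans (leq_addr m n) H) (leq_trans (leq_addl n m) H).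
Qed.

Lemma bsum_double (a : nat -> R) (b : nat -> nat -> R) (c C : R) :
  0 < c -> 0 <= C -> (forall n m, 0 <= b n m) -> (forall n, 0 <= a n) ->
  (forall n M, \sum_(0 <= m < M) b n m <= C * a n) ->
  (forall n, exists M, c * a n <= \sum_(0 <= m < M) b n m) ->
  bsum a <-> bsum (fun j => oapp (fun i => b i.1 i.2) 0 (pickle_inv j)).
Proof.
move=> c0 C0 b0 a0 up /choice[low Hlow]; rewrite bsum_pairs//; split=> -[M HM].
  exists (C * M) => N; apply: (@le_trans _ _ (\sum_(0 <= n < N) C * a n)).
    by apply: ler_sum => n _; exact: up.
  by rewrite -mulr_sumr ler_wpM2l.
exists (c^-1 * M) => N; rewrite -ler_pdivrMl ?invr_gt0// invrK.
(* A square containing the first [N] rows up to the lengths that their lower bounds need. *)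
pose K := (N + \max_(i < N) low i)%N.
apply: le_trans (HM K); rewrite mulr_sumr.
apply: (@le_trans _ _ (\sum_(0 <= n < N) \sum_(0 <= m < K) b n m)); last first.
  by apply: sum_nat_mono => [n|]; [exact: sumr_ge0|exact: leq_addr].
rewrite !big_nat; apply: ler_sum => n /andP[_ nN]; apply: le_trans (Hlow n) _.
apply: sum_nat_mono => //; apply: leq_trans (leq_addl _ _).
exact: (@leq_bigmax _ (fun i : 'I_N => low i) (Ordinal nN)).
Qed.

End double_sums.

(** * Reductions to [lr_equiv q] for q above p *)

Section upper_bound.
Context (R : realType) (p q : R).
Hypothesis p1 : 1 <= p.
Hypothesis pq : p < q.

Lemma continuous_coordinatewise (f : nat -> (nat -> int) -> R) :
  (forall j, exists n, forall x y, agree n x y -> f j x = f j y) ->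
  continuous (fun x : seqspace int => (fun j => f j x) : {ptws nat -> R}).
Proof.
move=> floc x.
pose F : set_system (nat -> R) := (fun y j => f j y) @ (x : seqspace int).
have FF : Filter F.
  split.
  - exact: (@filterT _ (nbhs (x : seqspace int)) _).
  - by move=> A B; exact: (@filterI _ (nbhs (x : seqspace int)) _).
  - by move=> A B AB; apply: (@filterS _ (nbhs (x : seqspace int)) _) => y /AB.
suff H : {ptws, F --> ((fun j => f j x) : nat -> R)} by [].
apply/pointwise_cvgP => j A /nbhs_singleton Ax.
have [n Hn] := floc j; apply/nbhs_seqspaceP; exists n => y xy.
by rewrite /= -(Hn x).
Qed.

Lemma borel_map_continuous (X Y : topologicalType) (f : X -> Y) :
  continuous f -> borel_map f.
Proof.
move=> cf; apply: borel_mapP => A oA; apply: borel_open.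
by apply: open_comp => // x _; exact: cf.
Qed.

(** The bound [s] keeps the exponents away from [q], so one pair of snowflake constants serves all
    coordinates. *)
Lemma Erel_reducible_lr (w e : nat -> R) (s : R) : (forall n, 0 < w n) ->
  (forall n, 1 <= e n <= s) -> s < q ->
  borel_reducible (Erel w e) (@lr_equiv R q).
Proof.
move=> w0 es sq.
have s1q : 1 <= s < q by rewrite sq andbT; have /andP[/le_trans] := es 0%N; exact.
have q0 : 0 < q by have /andP[s1 _] := s1q; lra.
have [C C0 HC] := scale_upper s1q; have [c c0 Hc] := scale_lower s1q.
(* Its q-th power at (n, m) is w_n 2^(m e_n), so the q-th power of an output difference is w_n times
   [scale]. *)
pose coef (i : nat * nat) := (w i.1 * (2 ^+ i.2) `^ e i.1) `^ q^-1.
pose f (j : nat) (x : nat -> int) : R :=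
  oapp (fun i => coef i * sin ((x i.1)%:~R / 2 ^+ i.2)) 0 (pickle_inv j).
exists (fun x : seqspace int => (fun j => f j x) : {ptws nat -> R}).
  apply: borel_map_continuous; apply: continuous_coordinatewise => j.
  rewrite /f; case: (pickle_inv j) => [[n m]|]; last by exists 0%N.
  by exists n.+1 => x y xy; rewrite /= xy.
move=> x y; rewrite lr_equivP /Erel.
rewrite (@bsum_double _ _ (fun n m => w n * scale (e n) q (x n) (y n) m) c C)//.
- rewrite (_ : (fun j => oapp _ _ _) = (fun j => `|f j x - f j y| `^ q))//.
  apply/funext => j; rewrite /f; case: (pickle_inv j) => [[n m]|] /=; last first.
    by rewrite subrr normr0 powR0// gt_eqF.
  rewrite -mulrBr normrM powRM// ger0_norm ?powR_ge0// -powRrM mulVf ?gt_eqF//.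
  by rewrite powRr1 ?mulr_ge0 ?powR_ge0 ?ltW// /scale mulrA.
- by move=> n m; rewrite mulr_ge0 ?scale_ge0 ?ltW.
- by move=> n; rewrite mulr_ge0 ?powR_ge0 ?ltW.
- move=> n M; rewrite -mulr_sumr /cost [leRHS]mulrCA.
  by apply: ler_wpM2l; [exact: ltW|exact: HC].
move=> n; have [M HM] := Hc (e n) (x n) (y n) (es n); exists M.
by rewrite -mulr_sumr /cost mulrCA; apply: ler_wpM2l; [exact: ltW|].
Qed.

Lemma reducible_lr_equiv (U : set nat) :
  borel_reducible (Erel (weight p U) (expo p U)) (@lr_equiv R q).
Proof.
pose s := (p + q) / 2.
have ps : p < s by have := pq; rewrite /s; lra.
have sq : s < q by have := pq; rewrite /s; lra.
have [K HK] : exists K, forall k, (K <= k)%N -> pexp p k <= s.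
  exists (Num.bound (s - p)^-1) => k Kk; rewrite /pexp -lerBrDl.
  rewrite invf_ple ?posrE ?subr_gt0//.
  have /archi_boundP/ltW/le_trans : 0 <= (s - p)^-1 by rewrite invr_ge0 subr_ge0 ltW.
  by apply; rewrite ler_nat leqW.
(* For the finitely many k < K the exponent is reset to p. The weights there are at least
   [alpha p K], so by [Erel_reducible] with all multipliers 1 the relation stays the same. *)
pose e n := if typ n is k.+1 then
  (if (k < K)%N then p else expo p U n) else expo p U n.
have expo1 n : 1 <= expo p U n <= p + 1.
  by have /andP[pe ->] := expo_bound p U n; rewrite (le_trans p1 pe).
have p01 : 1 <= p <= p + 1 by rewrite p1/= lerDl.
have e1 n : 1 <= e n <= p + 1.
  by rewrite /e; case: (typ n) => // k; case: ifP.
have es n : 1 <= e n <= s.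
  have /andP[-> _] := e1 n; rewrite /e /expo; case: (typ n) => [|k]; first exact: ltW.
  case: ltnP => [_|Kk]; first exact: ltW.
  by case: ifP => _; [exact: HK|exact: ltW].
have [th bth Hth] := Erel_reducible_lr (weight_gt0 p1 U) es sq.
exists th => // x y; rewrite -Hth.
have := @Erel_reducible R p (weight p U) (expo p U) (weight p U) e (fun=> 1%N)
  (alpha p K) (weight_gt0 p1 U) expo1 (weight_gt0 p1 U) e1 (alpha_gt0 p1 K) _ _ x y.
have id1 (z : nat -> int) : (fun n => 1%N%:Z * z n) = z.
  by apply/funext => n; rewrite mul1r.
rewrite !id1; apply=> // n; rewrite powR1 mulr1 /e /expo /weight.
case: (typ n) => [|k]; first by left.
have a1 : alpha p K <= 1.
  apply: le_trans (alpha_le p1 (leq0n K)) _.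
  rewrite /alpha big_ord1 invf_le1 ?alpha_factor_ge1//.
  exact: lt_le_trans ltr01 (alpha_factor_ge1 p1 _).
case: ltnP => [kK|_]; last by left.
by right; case: ifP => // _; rewrite alpha_le// ltnW.
Qed.

End upper_bound.

(** * The family on the space of integer sequences *)

Theorem theorem4p4 (R : realType) (p : R) (hp : 1 <= p) :
  exists (X : set nat -> topologicalType) (E : forall U : set nat, X U -> X U -> Prop),
    [/\ forall U : set nat,
          [/\ polish R (X U), Equivalence (E U) & borel_relation (E U)],
        forall (U : set nat) (q : R), p < q ->
          borel_reducible (lr_equiv p) (E U) /\
          borel_reducible (E U) (lr_equiv q) &
        forall U V : set nat,
          almost_subset U V <-> borel_reducible (E U) (E V)].
Proof.
exists (fun=> seqspace int), (fun U => Erel (weight p U) (expo p U)); split.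
- move=> U; have w0 := weight_gt0 hp U.
  have e1 n : 1 <= expo p U n <= p + 1.
    by have /andP[pe ->] := expo_bound p U n; rewrite (le_trans hp pe).
  split; [exact: (polish_seqspace R (0 : int))|exact: equivalence_Erel|].
  exact: borel_Erel.
- by move=> U q pq; split; [exact: lr_equiv_reducible|exact: reducible_lr_equiv].
move=> U V; split; first exact: reducible_of_almost_subset.
exact: almost_subset_of_reducible.
Qed.
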